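(* Let $E$ be a Wiener-holomorphic $\mathrm{GL}_n$-bundle on $\mathbb{C}P^1_{\mathbb{Q}}$ whose transition cocycle $g\in\mathrm{GL}_n(\mathfrak{W}_{\mathbb{Q}})$ has Fourier support contained in $N^{-1}\mathbb{Z}$ for some positive integer $N$ (equivalently, $E$ is the pullback $\pi_N^*E_N$ of a holomorphic $\mathrm{GL}_n$-bundle $E_N$ on $\mathbb{P}^1_N$). Then $$E\cong\mathcal{L}_{q_1}\oplus\cdots\oplus\mathcal{L}_{q_n},\qquad q_1\ge\cdots\ge q_n\in N^{-1}\mathbb{Z}\subset\mathbb{Q}.$$ In particular, $g$ admits a Birkhoff factorization $g=h_-^{-1}\operatorname{diag}(\chi_{q_1},\ldots,\chi_{q_n})\,h_+$ with $h_\pm\in\mathrm{GL}_n(\mathfrak{W}^\pm_{\mathbb{Q}})$.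
   Context: For each positive integer $N$ let $\mathbb{P}^1_N$ be a copy of the complex projective line with unit circle $S^1_N$; for $N\mid M$ the bonding map $\mathbb{P}^1_M\to\mathbb{P}^1_N$ is $z\mapsto z^{M/N}$. Then $\mathbb{C}P^1_{\mathbb{Q}}=\varprojlim\mathbb{P}^1_N$ and $S^1_{\mathbb{Q}}=\varprojlim S^1_N$, with projections $\pi_N$ to level $N$. $S^1_{\mathbb{Q}}$ is a compact abelian group with dual the discrete group $\mathbb{Q}$; for $q=k/N$ the character is $\chi_q=\pi_N^k$. $\mathfrak{W}_{\mathbb{Q}}$ is the Banach algebra of functions $f=\sum_{q\in\mathbb{Q}}a_q\chi_q$ on $S^1_{\mathbb{Q}}$ with $\sum_q|a_q|<\infty$, and $\mathfrak{W}^+_{\mathbb{Q}}$ (resp. $\mathfrak{W}^-_{\mathbb{Q}}$) is the subalgebra with $a_q=0$ for $q<0$ (resp. $q>0$). The Fourier support of a matrix function $\sum_q A_q\chi_q$ is $\{q:A_q\neq0\}$. $\mathbb{C}P^1_{\mathbb{Q}}$ is covered by two hemispheres $D^\pm_{\mathbb{Q}}$ (around $0$ and $\infty$) meeting along $S^1_{\mathbb{Q}}$; elements of $\mathfrak{W}^{\pm}_{\mathbb{Q}}$ are those Wiener functions extending holomorphically to $D^\pm_{\mathbb{Q}}$. A rank-$n$ Wiener-holomorphic ($\mathrm{GL}_n$-)bundle on $\mathbb{C}P^1_{\mathbb{Q}}$ is presented by a transition cocycle $g\in\mathrm{GL}_n(\mathfrak{W}_{\mathbb{Q}})$ gluing trivial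 bundles over the two hemispheres along $S^1_{\mathbb{Q}}$; changes of trivialization replace $g$ by $h_-^{-1}gh_+$ with $h_\pm\in\mathrm{GL}_n(\mathfrak{W}^\pm_{\mathbb{Q}})$, and two cocycles related in this way define isomorphic bundles (and conversely). $\mathcal{L}_q$ denotes the line bundle with transition cocycle $\chi_q$. *)

(* Defs.v *)
From HB Require Import structures.
From mathcomp Require Import all_boot all_order all_algebra finmap complex.
From mathcomp Require Import all_classical all_reals ereal topology normedtype.
From mathcomp Require Import esum summability.
Set Implicit Arguments.
Unset Strict Implicit.
Unset Printing Implicit Defensive.
Import Order.TTheory GRing.Theory Num.Theory.
Import numFieldNormedType.Exports.
Local Open Scope classical_set_scope.
Local Open Scope ring_scope.

#[export] Existing Instance totally_filter.

Definition pint := {N : nat | (0 < N)%N}.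

(* R[i], with its canonical structures (in particular its topology) found
   through numClosedFieldType. *)
Definition Cplx (R : realType) : numClosedFieldType := R[i]%C.

Definition circle (R : realType) := {z : Cplx R | `|z| == 1}.

(* S^1_Q, the inverse limit over N | M of the maps z |-> z ^ (M / N). *)
Record solenoid (R : realType) := Solenoid {
  proj : pint -> circle R;
  proj_compat : forall N M : pint, (val N %| val M)%N ->
    val (proj N) = val (proj M) ^+ (val M %/ val N) }.

Definition zpow (R : realType) (k : int) (z : circle R) : Cplx R := val z ^ k.

Lemma absz_denq_gt0 (q : rat) : (0 < `|denq q|)%N.
Proof. by rewrite absz_gt0 denq_neq0. Qed.

Definition denom (q : rat) : pint := exist _ `|denq q|%N (absz_denq_gt0 q).

(* See [chiE] for q = k / N not in lowest terms. *)
Definition chi (R : realType) (q : rat) (x : solenoid R) : Cplx R :=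
  zpow (numq q) (proj x (denom q)).

Lemma normCplx0 (R : realType) : Normc.normc (0 : Cplx R) = 0.
Proof. by rewrite /Normc.normc /= expr0n /= addr0 sqrtr0. Qed.

Section Wiener.
Variables (R : realType) (I : choiceType) (X : Type) (e : I -> X -> Cplx R).

Definition has_expansion (a : I -> Cplx R) (f : X -> Cplx R) : Prop :=
  esum.summable [set: I] (fun i => (Normc.normc (a i))%:E) /\
  forall x, partial_sum (fun i => a i * e i x) @ totally --> f x.

Definition wiener (D : set I) : set (X -> Cplx R) :=
  [set f | exists2 a, has_expansion a f & forall i, ~ D i -> a i = 0].

Definition mx_has_expansion m n (A : I -> 'M[Cplx R]_(m, n))
    (g : X -> 'M[Cplx R]_(m, n)) : Prop :=
  forall r s, has_expansion (fun i => A i r s) (fun x => g x r s).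

(* For the characters of the circle and of the solenoid the coefficients A
   are determined by g. *)
Definition fourier_support m n (g : X -> 'M[Cplx R]_(m, n)) : set I :=
  [set i | exists2 A, mx_has_expansion A g & A i != 0].

End Wiener.

Definition mx_over (R : realType) (X : Type) (W : set (X -> Cplx R)) m n
    (g : X -> 'M[Cplx R]_(m, n)) : Prop :=
  forall r s, W (fun x => g x r s).

Definition GLn (R : realType) (X : Type) (n : nat) (W : set (X -> Cplx R)) :
    set (X -> 'M[Cplx R]_n) :=
  [set g | [/\ mx_over W g, (forall x, g x \in unitmx) &
               mx_over W (fun x => invmx (g x))]].

Definition WQ (R : realType) : set (solenoid R -> Cplx R) :=
  wiener (@chi R) setT.
Definition WQplus (R : realType) : set (solenoid R -> Cplx R) :=
  wiener (@chi R) [set q | 0 <= q].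
Definition WQminus (R : realType) : set (solenoid R -> Cplx R) :=
  wiener (@chi R) [set q | q <= 0].

Definition Wcircle (R : realType) : set (circle R -> Cplx R) :=
  wiener (@zpow R) setT.

(* Rank-n bundles on CP^1_Q, presented by a transition cocycle along S^1_Q. *)
Record bundle (R : realType) (n : nat) := Bundle {
  cocycle : solenoid R -> 'M[Cplx R]_n;
  cocycleP : GLn (@WQ R) cocycle }.

(* Rank-n bundles on a copy of P^1, presented by a transition cocycle along
   the unit circle. *)
Record bundleP1 (R : realType) (n : nat) := BundleP1 {
  cocycleP1 : circle R -> 'M[Cplx R]_n;
  cocycleP1P : GLn (@Wcircle R) cocycleP1 }.

Definition is_pullback (R : realType) (n : nat) (N : pint)
    (EN : bundleP1 R n) (E : bundle R n) : Prop :=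
  forall x, cocycle E x = cocycleP1 EN (proj x N).

Definition bundle_iso (R : realType) (n : nat) (E F : bundle R n) : Prop :=
  exists hm hp : solenoid R -> 'M[Cplx R]_n,
    [/\ GLn (@WQminus R) hm, GLn (@WQplus R) hp &
        forall x, cocycle F x = invmx (hm x) *m cocycle E x *m hp x].

(* N^{-1} Z *)
Definition invZ (N : pint) : set rat :=
  [set q | exists k : int, q = k%:~R / (val N)%:R].

Section Chi.
Variable R : realType.
Implicit Types (x : solenoid R) (q : rat).

Lemma circle_neq0 (z : circle R) : val z != 0.
Proof. by rewrite -normr_gt0 (eqP (valP z)) ltr01. Qed.

Lemma chi_neq0 q x : chi q x != 0.
Proof. by rewrite expfz_neq0 // circle_neq0. Qed.

Lemma chiN q x : chi (- q) x = (chi q x)^-1.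
Proof.
rewrite /chi /zpow numqN.
have -> : denom (- q) = denom q by apply: val_inj; rewrite /= denqN.
by rewrite invr_expz.
Qed.

Lemma chiE (N : pint) (k : int) x :
  chi (k%:~R / (val N)%:R) x = zpow k (proj x N).
Proof.
have N0 : (val N)%:R != 0 :> rat by rewrite pnatr_eq0 -lt0n (valP N).
set q := _ / _; have qk : q * (val N)%:R = k%:~R by rewrite divfK.
have qN : numq q * (val N)%:Z = k * denq q.
  apply: (@intr_inj rat); rewrite !intrM numqE -qk. exact: mulrAC.
have dN : (val (denom q) %| val N)%N.
  have : (denq q %| numq q * (val N)%:Z)%Z by rewrite qN dvdz_mull.
  rewrite Gauss_dvdzr ?dvdzE // coprimezE coprime_sym.
  exact: coprime_num_den.
rewrite /chi /zpow (proj_compat x dN) exprnP exprz_exp.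
congr (_ ^ _).
have d0 : denq q != 0 := denq_neq0 q.
apply: (mulIf d0); rewrite -qN mulrAC [RHS]mulrC; congr (_ * _).
rewrite -[X in _ * X = _]absz_denq -PoszM divnK //.
Qed.

End Chi.

Section Monomial.
Variables (R : realType) (I : choiceType) (X : Type) (e : I -> X -> Cplx R).

Lemma wiener_monomial (D : set I) (c : Cplx R) i0 :
  D i0 -> wiener e D (fun x => c * e i0 x).
Proof.
move=> Di0; exists (fun i => if i == i0 then c else 0); last first.
  by move=> i Di; case: eqP => // ii0; case: Di; rewrite ii0.
split.
  rewrite /esum.summable (_ : \esum_(_ in _) _ =
    \esum_(i in [set i0]) (`|Normc.normc c|)%:E)%E.
    by rewrite esum_set1 ?ltry // lee_fin.
  rewrite [RHS]esum_mkcond; apply: eq_esum => i _ /=.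
  have [->|ii0] := eqVneq i i0; first by rewrite mem_set.
  rewrite memNset; last by move=> /= /eqP; rewrite (negbTE ii0).
  by rewrite normCplx0 ?abse0 ?normr0.
move=> x; apply: cvg_near_cst; exists [fset i0]%fset => //= A iA.
have i0A : i0 \in A by apply: (fsubsetP iA); rewrite inE.
rewrite /partial_sum /= (bigD1 [` i0A]%fset) //= eqxx big1 ?addr0 //.
move=> i; rewrite -val_eqE /= => /negbTE ->; exact: mul0r.
Qed.

Lemma wiener0 (D : set I) : wiener e D (fun=> 0).
Proof.
exists (fun=> 0) => //; split.
  rewrite /esum.summable esum1 ?ltry // => i _.
  by rewrite normCplx0 ?abse0 ?normr0.
move=> x; apply: cvg_near_cst; apply: nearW => A.
by rewrite /partial_sum big1 // => i _; rewrite mul0r.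
Qed.

End Monomial.

Section Bundles.
Variable R : realType.

Lemma line_cocycleP (q : rat) :
  GLn (@WQ R) (fun x => (chi q x)%:M : 'M[Cplx R]_1).
Proof.
have W1 p : mx_over (@WQ R) (fun x => (chi p x)%:M : 'M[Cplx R]_1).
  move=> r s; have := @wiener_monomial R _ _ (@chi R) setT 1 p Logic.I.
  by congr (wiener _ _ _); apply/funext => x; rewrite mul1r !ord1 mxE eqxx.
split=> [//|x|r s].
  by rewrite unitmxE det_scalar1 unitfE chi_neq0.
have := W1 (- q) r s; congr (WQ _); apply/funext => x.
by rewrite chiN invmx_scalar.
Qed.

Definition line (q : rat) : bundle R 1 := Bundle (line_cocycleP q).

Lemma invmx_diag n (d : 'rV[Cplx R]_n) : (forall i, d 0 i != 0) ->
  diag_mx d \in unitmx /\ invmx (diag_mx d) = diag_mx (\row_i (d 0 i)^-1).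
Proof.
move=> d0; set d' := \row_i _.
have dd' : diag_mx d *m diag_mx d' = 1%:M.
  rewrite mulmx_diag -diag_const_mx; congr diag_mx.
  by apply/rowP => i; rewrite !mxE mulfV.
have [du _] := mulmx1_unit dd'.
by split=> //; rewrite -[RHS]mul1mx -(mulVmx du) -mulmxA dd' mulmx1.
Qed.

Lemma dsum_lines_cocycleP n (L : 'I_n -> bundle R 1) :
  GLn (@WQ R) (fun x => diag_mx (\row_i cocycle (L i) x 0 0)).
Proof.
have L0 i x : cocycle (L i) x 0 0 != 0.
  have [_ /(_ x) + _] := cocycleP (L i).
  by rewrite {1}(mx11_scalar (cocycle (L i) x)) unitmxE det_scalar1 unitfE.
have W1 (f : 'I_n -> solenoid R -> Cplx R) : (forall i, WQ (f i)) ->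
    mx_over (@WQ R) (fun x => diag_mx (\row_i f i x)).
  move=> Wf r s; have [rs|rs] := eqVneq r s.
    have := Wf r; congr (WQ _); apply/funext => x.
    by rewrite !mxE rs eqxx.
  have := @wiener0 R _ _ (@chi R) setT; congr (wiener _ _ _).
  by apply/funext => x; rewrite !mxE (negbTE rs).
split.
- by apply: W1 => i; have [+ _ _] := cocycleP (L i); apply.
- by move=> x; apply: (invmx_diag _).1 => i; rewrite mxE.
- move=> r s; have := @W1 (fun i x => (cocycle (L i) x 0 0)^-1) _ r s.
  have -> : (fun x => diag_mx (\row_i (cocycle (L i) x 0 0)^-1) r s) =
            (fun x => invmx (diag_mx (\row_i cocycle (L i) x 0 0)) r s).
    apply/funext => x; rewrite (invmx_diag _).2 => [|i]; last by rewrite mxE.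
    by congr (diag_mx _ r s); apply/rowP => i; rewrite !mxE.
  apply=> i; have [_ _ /(_ 0 0)] := cocycleP (L i).
  congr (WQ _); apply/funext => x.
  by rewrite {1}(mx11_scalar (cocycle (L i) x)) invmx_scalar mxE eqxx.
Qed.

Definition dsum_lines n (L : 'I_n -> bundle R 1) : bundle R n :=
  Bundle (dsum_lines_cocycleP L).

End Bundles.

(* Main.v *)
Require Import Defs.
From mathcomp Require Import all_boot all_order all_algebra perm finmap complex.
From mathcomp Require Import all_classical all_reals ereal topology normedtype.
From mathcomp Require Import sequences esum summability.
From mathcomp Require Import zify ring lra.
Set Implicit Arguments.
Unset Strict Implicit.
Unset Printing Implicit Defensive.
Import Order.TTheory GRing.Theory Num.Theory.
Import numFieldNormedType.Exports.
(* restores [proj] as the projection of the solenoid *)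
Import Defs.
Local Open Scope classical_set_scope.
Local Open Scope ring_scope.

(** Write W for absolutely convergent series of characters, W+ and W- for the
    subalgebras of series with frequencies of one sign.

    Descent.  A cocycle with frequencies in N^-1 Z is visibly a Laurent series
    in the coordinate at level N, so it comes from the circle at that level.
    The inverse cocycle also has its frequencies in N^-1 Z: split it as h + h'
    by frequency; then g h - 1 has frequencies in N^-1 Z, while it equals
    - g h', whose frequencies all lie outside, and both vanish because
    Fourier coefficients are unique [mx_over_inverse_supp].  Uniqueness on the
    solenoid [chi_indep] holds because averaging a series over finitely many
    powers of one well chosen point t kills any given finite set of nontrivial
    characters; t exists because every point of the circle at a level lifts to
    the solenoid [proj_surj].

    Birkhoff factorization on the circle [circle_birkhoff].  The analysis is
    confined to loops near the identity: for small g the equation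
    (1 + g)(1 + x) = 1 + y, with the frequencies of x and y prescribed to lie
    in complementary half lines, is solved by a geometric iteration
    [wiener_factor_step].  So 1 + g = h+ h- [wiener_factor_small].  Applying
    this twice to quotients of a loop by a trigonometric polynomial close to
    it makes the loop a Laurent polynomial matrix, up to factors on the
    admissible sides: the second time, the same matrix has frequencies bounded
    above for one reason and bounded below for another [laurent_reduction].

    What remains is algebra over C[z].  Roots of the determinant outside the
    unit disc are peeled off to the right, into W+ [split_roots].  Column
    reduction, the Grothendieck argument for splitting bundles on the
    projective line, makes the matrix of leading coefficients of the columns
    invertible [column_reduce]; dividing each column by its top power of z
    then leaves a polynomial matrix in z^-1 that is invertible on the whole
    outer disc, infinity included, hence a member of GL_n(W-)
    [reverse_columns, GLn_mxeval].  The powers of z taken out are the partial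
    indices; they are sorted by a permutation, which is constant and so
    belongs to both sides, and the factorization is pulled back along the
    projection to level N. *)

(** * Absolutely convergent real families *)

Section RealSums.
Variable R : realType.

Lemma addr_ge0_norm (x y : R) : `|x| <= y -> 0 <= x + y <= y + y.
Proof. by rewrite ler_norml; lra. Qed.

(** Sums of nonnegative families are taken in the extended reals, where they
    always exist and rearrangement needs no hypothesis. *)
Definition esumR (J : choiceType) (u : J -> R) : \bar R :=
  \esum_(j in [set: J]) (u j)%:E.

Lemma esumR_ge0 (J : choiceType) (u : J -> R) :
  (forall j, 0 <= u j) -> (0 <= esumR u)%E.
Proof. by move=> u0; apply: esum_ge0 => j _; rewrite lee_fin. Qed.

Lemma le_esumR (J : choiceType) (u v : J -> R) :
  (forall j, u j <= v j) -> (esumR u <= esumR v)%E.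
Proof. by move=> uv; apply: le_esum => j _; rewrite lee_fin. Qed.

Lemma esumRD (J : choiceType) (u v : J -> R) :
  (forall j, 0 <= u j) -> (forall j, 0 <= v j) ->
  esumR (fun j => (u j + v j)%R) = (esumR u + esumR v)%E.
Proof.
move=> u0 v0; rewrite /esumR -esumD => [|j _|j _]; try by rewrite lee_fin.
by apply: eq_esum => j _; rewrite EFinD.
Qed.

Lemma fsum_le_esumR (J : choiceType) (u : J -> R) (A : {fset J}) :
  ((\sum_(j <- A) u j)%:E <= esumR u)%E.
Proof.
apply: esum_ge; exists [set` A]; first by split.
by rewrite fsbig_finite// set_fsetK sumEFin.
Qed.

Lemma esumR_le (J : choiceType) (u : J -> R) (c : R) :
  (forall A : {fset J}, \sum_(j <- A) u j <= c) -> (esumR u <= c%:E)%E.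
Proof.
move=> uc; apply: ge_ereal_sup => _ /= [A [finA _] <-].
by rewrite fsbig_finite// sumEFin lee_fin.
Qed.

Lemma esumR_fin (J : choiceType) (u : J -> R) :
  (forall j, 0 <= u j) -> (esumR u < +oo)%E -> esumR u = (fine (esumR u))%:E.
Proof.
move=> u0 uoo; rewrite fineK// fin_numElt uoo andbT.
by rewrite (lt_le_trans (ltNyr 0))// esumR_ge0.
Qed.

Lemma esumR_approx (J : choiceType) (u : J -> R) (e : R) :
  (forall j, 0 <= u j) -> (esumR u < +oo)%E -> 0 < e ->
  exists A0 : {fset J}, forall A : {fset J}, (A0 `<=` A)%fset ->
    fine (esumR u) - e < \sum_(j <- A) u j <= fine (esumR u).
Proof.
move=> u0 uoo e0; have uE := esumR_fin u0 uoo.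
have : ((fine (esumR u) - e)%:E < esumR u)%E.
  by rewrite [ltRHS]uE lte_fin ltrBlDr ltrDl.
move=> /ereal_sup_gt[_ [X [finX _] <-]].
rewrite fsbig_finite// sumEFin lte_fin => lt.
exists (fset_set X) => A XA; apply/andP; split.
  apply: lt_le_trans lt _.
  rewrite (big_fsetID _ (mem (fset_set X)) A)/=.
  rewrite (_ : [fset x in A | x \in fset_set X]%fset = fset_set X).
    by rewrite lerDl sumr_ge0.
  apply/fsetP => x; rewrite !inE/=.
  by case: (boolP (x \in fset_set X)) => [/(fsubsetP XA)->|]; rewrite ?andbF.
by have := fsum_le_esumR u A; rewrite [leRHS]uE lee_fin.
Qed.

(** Both iterated sums equal the sum over the product of the index types. *)
Lemma esumR_exchange (J K : choiceType) (u : J -> K -> R) :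
  (forall j k, 0 <= u j k) ->
  (\esum_(j in [set: J]) esumR (u j) =
   \esum_(k in [set: K]) esumR (fun j => u j k))%E.
Proof.
move=> u0; rewrite /esumR esum_esum; last by move=> *; rewrite lee_fin.
rewrite esum_esum; last by move=> *; rewrite lee_fin.
rewrite (reindex_esum ([set: K] `*`` (fun=> [set: J])) _ (fun x => (x.2, x.1)))//.
split=> //=; first by move=> [i1 i2] [j1 j2] /= _ _ [] -> ->.
by move=> [j k] _; exists (k, j).
Qed.

(** Adding the absolute value keeps the family nonnegative, so that theorems on
    nonnegative sums carry over by one subtraction.  [rsumE] allows any other
    summable majorant in place of the absolute value. *)
Definition rsum (J : choiceType) (u : J -> R) : R :=
  fine (esumR (fun j => (u j + `|u j|)%R)) - fine (esumR (fun j => `|u j|%R)).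

(** The two differences agree because
    (u + |u|) + h = (u + h) + |u| termwise and all four sums are finite.  The
    freedom in h is what makes exchange of summation work: the majorant of an
    inner sum is not its absolute value. *)
Lemma rsumE (J : choiceType) (u h : J -> R) :
  (forall j, `|u j| <= h j) -> (esumR h < +oo)%E ->
  rsum u = fine (esumR (fun j => (u j + h j)%R)) - fine (esumR h).
Proof.
move=> uh hoo.
have h0 j : 0 <= h j by apply: le_trans (uh j).
have a0 j : 0 <= u j + `|u j|.
  by have /andP[] := addr_ge0_norm (lexx `|u j|).
have b0 j : 0 <= u j + h j.
  by have /andP[] := addr_ge0_norm (uh j).
have n0 j : 0 <= `|u j| by [].
have hoo2 : (esumR (fun j => (h j + h j)%R) < +oo)%E by rewrite esumRD// lte_add_pinfty.
have noo : (esumR (fun j => `|u j|%R) < +oo)%E by apply: le_lt_trans hoo; apply: le_esumR.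
have aoo : (esumR (fun j => (u j + `|u j|)%R) < +oo)%E.
  apply: le_lt_trans hoo2; apply: le_esumR => j.
  by have := ler_norm (u j); have := uh j; lra.
have boo : (esumR (fun j => (u j + h j)%R) < +oo)%E.
  apply: le_lt_trans hoo2; apply: le_esumR => j.
  by have /andP[] := addr_ge0_norm (uh j).
have : (esumR (fun j => (u j + `|u j|)%R) + esumR h =
        esumR (fun j => (u j + h j)%R) + esumR (fun j => `|u j|%R))%E.
  rewrite -!esumRD//; apply: eq_esum => j _; congr EFin; ring.
rewrite /rsum; rewrite (esumR_fin a0 aoo) (esumR_fin b0 boo) (esumR_fin n0 noo).
rewrite (esumR_fin h0 hoo) -!EFinD => -[]/=; lra.
Qed.

Lemma rsum_approx (J : choiceType) (u : J -> R) (e : R) :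
  (esumR (fun j => `|u j|%R) < +oo)%E -> 0 < e ->
  exists A0 : {fset J}, forall A : {fset J}, (A0 `<=` A)%fset ->
    `|rsum u - \sum_(j <- A) u j| < e.
Proof.
move=> uoo e0.
have a0 j : 0 <= u j + `|u j| by have /andP[] := addr_ge0_norm (lexx `|u j|).
have n0 j : 0 <= `|u j| by [].
have aoo : (esumR (fun j => (u j + `|u j|)%R) < +oo)%E.
  apply: (@le_lt_trans _ _ (esumR (fun j => (`|u j| + `|u j|)%R))).
    by apply: le_esumR => j; rewrite lerD2r ler_norm.
  by rewrite esumRD// lte_add_pinfty.
have [A1 H1] := esumR_approx a0 aoo e0.
have [A2 H2] := esumR_approx n0 uoo e0.
exists (A1 `|` A2)%fset => A; rewrite fsubUset => /andP[/H1 h1 /H2 h2].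
move: h1 h2; rewrite big_split/= /rsum ltr_norml; lra.
Qed.

(** With a common majorant h, each iterated sum is the difference of the
    iterated sums of the nonnegative families u + h and h, for which
    [esumR_exchange] applies. *)
Lemma rsum_exchange (J K : choiceType) (u h : J -> K -> R) :
  (forall j k, `|u j k| <= h j k) ->
  (\esum_(j in [set: J]) esumR (h j) < +oo)%E ->
  rsum (fun j => rsum (u j)) = rsum (fun k => rsum (fun j => u j k)).
Proof.
move=> uh hoo.
have main (J' K' : choiceType) (v g : J' -> K' -> R) :
    (forall j k, `|v j k| <= g j k) ->
    (\esum_(j in [set: J']) esumR (g j) < +oo)%E ->
    rsum (fun j => rsum (v j)) =
    fine (\esum_(j in [set: J']) esumR (fun k => (v j k + g j k)%R)) -
    fine (\esum_(j in [set: J']) esumR (g j)).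
  move=> vg goo.
  have g0 j k : 0 <= g j k by apply: le_trans (vg j k).
  have goo1 j : (esumR (g j) < +oo)%E.
    have : esum.summable [set: J'] (fun j => esumR (g j)).
      rewrite /esum.summable (eq_esum (b := fun j => esumR (g j)))// => i _.
      by rewrite gee0_abs// esumR_ge0.
    move=> /summable_pinfty /(_ j Logic.I).
    by rewrite gee0_abs// esumR_ge0.
  have gE j := esumR_fin (g0 j) (goo1 j).
  have b0 j k : 0 <= v j k + g j k.
    by have /andP[] := addr_ge0_norm (vg j k).
  have boo j : (esumR (fun k => (v j k + g j k)%R) < +oo)%E.
    apply: (@le_lt_trans _ _ (esumR (fun k => (g j k + g j k)%R))).
      by apply: le_esumR => k; have /andP[] := addr_ge0_norm (vg j k).
    by rewrite esumRD// lte_add_pinfty.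
  have bE j := esumR_fin (b0 j) (boo j).
  rewrite (@rsumE _ _ (fun j => fine (esumR (g j)))).
  - congr (fine _ - fine _); apply: eq_esum => j _; last by rewrite [RHS]gE.
    by rewrite (rsumE (vg j))// subrK [RHS]bE.
  - move=> j; rewrite (rsumE (vg j))//.
    have ge : (esumR (fun k => (v j k + g j k)%R) <= esumR (fun k => (g j k + g j k)%R))%E.
      by apply: le_esumR => k; have /andP[] := addr_ge0_norm (vg j k).
    have : 0 <= fine (esumR (fun k => (v j k + g j k)%R)).
      by rewrite fine_ge0// esumR_ge0.
    move: ge; rewrite (esumRD (g0 j) (g0 j)) (gE j) (bE j) -EFinD lee_fin ler_norml; lra.
  - apply: le_lt_trans goo; rewrite le_eqVlt; apply/orP; left; apply/eqP.
    by apply: eq_esum => j _; rewrite [RHS]gE.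
rewrite (main _ _ _ _ uh hoo).
have h0 j k : 0 <= h j k by apply: le_trans (uh j k).
have hx := esumR_exchange h0.
rewrite (main _ _ (fun k j => u j k) (fun k j => h j k)) => [|k j//|]; last first.
  by rewrite -hx.
rewrite -hx (@esumR_exchange _ _ (fun j k => u j k + h j k))// => j k.
by have /andP[] := addr_ge0_norm (uh j k).
Qed.

Lemma esumR_reindex (J K : choiceType) (s : J -> K) (u : K -> R) :
  injective s -> (forall k, ~ range s k -> u k = 0) ->
  esumR u = esumR (fun j => u (s j)).
Proof.
move=> si u0; transitivity (\esum_(k in range s) (u k)%:E).
  rewrite [RHS]esum_mkcond; apply: eq_esum => k _.
  by case: ifPn => // /negP sk; rewrite u0// => /mem_set.
by rewrite esum_image// => x y _ _; exact: si.
Qed.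

Lemma rsum_reindex (J K : choiceType) (s : J -> K) (u : K -> R) :
  injective s -> (forall k, ~ range s k -> u k = 0) ->
  rsum u = rsum (fun j => u (s j)).
Proof.
move=> si u0; rewrite /rsum !(esumR_reindex si)// => k /u0 ->; rewrite ?normr0//.
by rewrite addr0.
Qed.

End RealSums.

(** * Absolutely convergent complex families *)

Section ComplexSums.
Variable R : realType.
Local Notation C := (Cplx R).

(** The modulus with values in R; the norm of Cplx R takes values in Cplx R. *)
Definition nrm (z : C) : R := Normc.normc z.

Lemma normr_nrm (z : C) : `|z| = (nrm z)%:C%C :> R[i]. Proof. by []. Qed.

Lemma nrm_ge0 (z : C) : 0 <= nrm z.
Proof. by rewrite -ler0c -normr_nrm normr_ge0. Qed.

Lemma nrm0 : nrm 0 = 0. Proof. exact: normCplx0. Qed.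

Lemma nrm0_eq0 (z : C) : nrm z = 0 -> z = 0.
Proof. exact: Normc.eq0_normc. Qed.

Lemma nrm1 : nrm 1 = 1. Proof. exact: Normc.normc1. Qed.

Lemma nrmM (z w : C) : nrm (z * w) = nrm z * nrm w.
Proof. exact: Normc.normcM. Qed.

Lemma nrmN (z : C) : nrm (- z) = nrm z. Proof. exact: normcN. Qed.

Lemma le_nrmD (z w : C) : nrm (z + w) <= nrm z + nrm w.
Proof. exact: le_normcD. Qed.

Lemma nrmV (z : C) : nrm z^-1 = (nrm z)^-1.
Proof. exact: Normc.normcV. Qed.

Lemma nrmX (z : C) n : nrm (z ^+ n) = nrm z ^+ n.
Proof. by elim: n => [|n IH]; rewrite ?nrm1// !exprS nrmM IH. Qed.

Lemma nrm_nat n : nrm n%:R = n%:R.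
Proof.
by apply: complexI; rewrite -normr_nrm normr_nat rmorph_nat.
Qed.

Lemma le_nrm_sum (J : Type) (s : seq J) (P : pred J) (F : J -> C) :
  nrm (\sum_(j <- s | P j) F j) <= \sum_(j <- s | P j) nrm (F j).
Proof.
elim/big_ind2 : _ => [|x1 x2 y1 y2 h1 h2|//]; first by rewrite nrm0.
by apply: le_trans (le_nrmD _ _) _; apply: lerD.
Qed.

Lemma nrm_Re (z : C) : `|complex.Re z| <= nrm z.
Proof. by rewrite -lecR normc_ge_Re. Qed.

Lemma nrm_Im (z : C) : `|complex.Im z| <= nrm z.
Proof.
case: z => a b; rewrite /nrm/= -sqrtr_sqr ler_wsqrtr// lerDr; exact: sqr_ge0.
Qed.

Lemma nrm_le_ReIm (z : C) : nrm z <= `|complex.Re z| + `|complex.Im z|.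
Proof.
have {1}-> : z = (complex.Re z +i* 0)%C + (0 +i* complex.Im z)%C.
  by case: z => a b; apply/eqP; rewrite eq_complex/= addr0 add0r !eqxx.
apply: le_trans (le_nrmD _ _) _.
by rewrite /nrm/= expr0n/= addr0 add0r !sqrtr_sqr.
Qed.

Lemma Re_sum (J : Type) (s : seq J) (F : J -> C) :
  complex.Re (\sum_(j <- s) F j) = \sum_(j <- s) complex.Re (F j).
Proof.
elim: s => [|j s IH]; first by rewrite !big_nil.
by rewrite !big_cons -IH; case: (F j) (\sum_(_ <- _) _) => a b [c d].
Qed.

Lemma Im_sum (J : Type) (s : seq J) (F : J -> C) :
  complex.Im (\sum_(j <- s) F j) = \sum_(j <- s) complex.Im (F j).
Proof.
elim: s => [|j s IH]; first by rewrite !big_nil.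
by rewrite !big_cons -IH; case: (F j) (\sum_(_ <- _) _) => a b [c d].
Qed.

(** The l^1 norm, infinite when the family is not summable. *)
Definition mass (J : choiceType) (b : J -> C) : \bar R := esumR (nrm \o b).

Definition csum (J : choiceType) (b : J -> C) : C :=
  (rsum (fun j => complex.Re (b j)) +i* rsum (fun j => complex.Im (b j)))%C.

Lemma mass_ge0 (J : choiceType) (b : J -> C) : (0 <= mass b)%E.
Proof. by apply: esumR_ge0 => j; exact: nrm_ge0. Qed.

Lemma summable_mass (J : choiceType) (b : J -> C) :
  esum.summable [set: J] (fun j => (Normc.normc (b j))%:E) = (mass b < +oo)%E.
Proof.
rewrite /esum.summable /mass /esumR; congr (_ < _)%E; apply: eq_esum => j _.
by rewrite /= ger0_norm// nrm_ge0.
Qed.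

Section Family.
Variable J : choiceType.
Implicit Types b : J -> C.

Lemma csum_approx b (e : R) : (mass b < +oo)%E -> 0 < e ->
  exists A0 : {fset J}, forall A : {fset J}, (A0 `<=` A)%fset ->
    nrm (csum b - \sum_(j <- A) b j) < e.
Proof.
move=> boo e0; have e2 : 0 < e / 2 by rewrite divr_gt0.
have [A1 H1] := @rsum_approx R J (fun j => complex.Re (b j)) (e / 2)
  (le_lt_trans (le_esumR (fun j => nrm_Re (b j))) boo) e2.
have [A2 H2] := @rsum_approx R J (fun j => complex.Im (b j)) (e / 2)
  (le_lt_trans (le_esumR (fun j => nrm_Im (b j))) boo) e2.
exists (A1 `|` A2)%fset => A; rewrite fsubUset => /andP[/H1 h1 /H2 h2].
apply: le_lt_trans (nrm_le_ReIm _) _; rewrite (splitr e).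
apply: ltrD; [move: h1; rewrite -Re_sum | move: h2; rewrite -Im_sum];
  by case: (\sum_(_ <- _) _).
Qed.

Lemma csum_cvg b : (mass b < +oo)%E ->
  partial_sum b @ totally --> (csum b : C).
Proof.
move=> boo; apply/cvgrPdist_lt => /= e e0.
have e0' : 0 < e :> R[i] := e0.
have eE : e = (complex.Re e)%:C%C.
  by case: (e) e0' => a b'; rewrite ltcE/= => /andP[/eqP ->].
have e1 : 0 < complex.Re e by move: e0'; rewrite ltcE/= => /andP[].
have [A0 H0] := csum_approx boo e1.
exists A0 => //= A A0A; rewrite /partial_sum eE normr_nrm ltcR.
by rewrite -(big_seq_fsetE _ A xpredT (fun j => b j)) H0.
Qed.

(** Limits along finite subsets are unique, so every expansion computes [csum]. *)
Lemma csum_unique b (s : C) : (mass b < +oo)%E ->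
  partial_sum b @ totally --> s -> s = csum b.
Proof.
move=> boo bs; have H : hausdorff_space C by apply: norm_hausdorff.
have P : ProperFilter (partial_sum b @ totally) by apply: fmap_proper_filter.
exact: (@cvg_unique _ H (partial_sum b @ totally) P s _ bs (csum_cvg boo)).
Qed.

Lemma eq_csum b b' : b =1 b' -> csum b = csum b'.
Proof. by move=> /funext ->. Qed.

Lemma mass_le b (c : R) : (forall A : {fset J}, \sum_(j <- A) nrm (b j) <= c) ->
  (mass b <= c%:E)%E.
Proof. exact: esumR_le. Qed.

Lemma massD b b' : (mass (fun j => (b j + b' j)%R) <= mass b + mass b')%E.
Proof.
rewrite /mass -esumRD => [|j|j]; try exact: nrm_ge0.
by apply: le_esumR => j; exact: le_nrmD.
Qed.

Lemma csumD b b' : (mass b < +oo)%E -> (mass b' < +oo)%E ->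
  csum (fun j => b j + b' j) = csum b + csum b'.
Proof.
move=> boo boo'; apply/esym; apply: csum_unique.
  by apply: le_lt_trans (massD _ _) _; rewrite lte_add_pinfty.
rewrite (_ : partial_sum _ = partial_sum b \+ partial_sum b').
  exact: (@cvgD _ _ _ totally _ _ _ _ _ (csum_cvg boo) (csum_cvg boo')).
by apply/funext => A; rewrite /partial_sum big_split.
Qed.

Lemma massZ (z : C) b : (mass b < +oo)%E ->
  mass (fun j => (z * b j)%R) = (nrm z * fine (mass b))%:E.
Proof.
move=> boo.
have [-> | z0] := eqVneq z 0.
  rewrite nrm0 mul0r /mass/esumR esum1// => j _ /=.
  by rewrite mul0r nrm0.
have z1 : 0 < nrm z.
  by rewrite lt_neqAle nrm_ge0 andbT eq_sym; apply: contra_neq z0; exact: nrm0_eq0.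
have bE : mass b = (fine (mass b))%:E.
  by apply: esumR_fin boo => j; exact: nrm_ge0.
apply/eqP; rewrite eq_le; apply/andP; split.
  apply: mass_le => A; under eq_bigr do rewrite nrmM.
  rewrite -big_distrr/= ler_wpM2l ?nrm_ge0//.
  by rewrite -lee_fin -bE; exact: (@fsum_le_esumR _ _ (nrm \o b)).
have zoo : (mass (fun j => z * b j)%R < +oo)%E.
  apply: (@le_lt_trans _ _ (nrm z * fine (mass b))%:E); last exact: ltry.
  apply: mass_le => A; under eq_bigr do rewrite nrmM.
  rewrite -big_distrr/= ler_wpM2l ?nrm_ge0//.
  by rewrite -lee_fin -bE; exact: (@fsum_le_esumR _ _ (nrm \o b)).
have zE : mass (fun j => z * b j)%R = (fine (mass (fun j => z * b j)%R))%:E.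
  by apply: esumR_fin zoo => j; exact: nrm_ge0.
rewrite zE lee_fin -ler_pdivlMl// -lee_fin -bE.
apply: mass_le => A; rewrite ler_pdivlMl// big_distrr/=.
under eq_bigr do rewrite -nrmM.
by rewrite -lee_fin -zE; exact: (@fsum_le_esumR _ _ (nrm \o (fun j => z * b j))).
Qed.

Lemma csumZ (z : C) b : (mass b < +oo)%E ->
  csum (fun j => z * b j) = z * csum b.
Proof.
move=> boo; apply/esym; apply: csum_unique; first by rewrite massZ// ltry.
rewrite (_ : partial_sum _ = cst z \* partial_sum b).
  exact: (@cvgM C _ totally _ _ _ _ _ (cvg_cst z) (csum_cvg boo)).
by apply/funext => A; rewrite /partial_sum /= big_distrr.
Qed.

Lemma csum_norm b (c : R) : (mass b <= c%:E)%E -> nrm (csum b) <= c.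
Proof.
move=> bc; have boo : (mass b < +oo)%E by apply: le_lt_trans bc (ltry _).
apply/ler_addgt0Pr => e e0; have [A H] := csum_approx boo e0.
rewrite -[csum b](subrK (\sum_(j <- A) b j)) (addrC c).
apply: le_trans (le_nrmD _ _) (lerD (ltW (H _ (fsubset_refl _))) _).
apply: le_trans (le_nrm_sum _ _ _) _.
by rewrite -lee_fin; apply: le_trans bc; exact: (@fsum_le_esumR _ _ (nrm \o b)).
Qed.

Lemma fin_supp_mass b (A : {fset J}) : (forall j, j \notin A -> b j = 0) ->
  mass b = (\sum_(j <- A) nrm (b j))%:E.
Proof.
move=> b0; apply/eqP; rewrite eq_le; apply/andP; split; last first.
  exact: (@fsum_le_esumR _ _ (nrm \o b)).
apply: mass_le => B; rewrite (big_fsetID _ (mem A) B)/= [X in _ + X]big1_fset.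
  rewrite addr0 [leRHS](big_fsetID _ (mem B))/=.
  rewrite (_ : [fset x in B | x \in A]%fset = [fset x in A | x \in B]%fset).
    by rewrite lerDl sumr_ge0// => j _; exact: nrm_ge0.
  by apply/fsetP => x; rewrite !inE andbC.
by move=> j; rewrite !inE/= => /andP[_ /b0->] _; exact: nrm0.
Qed.

(** The net of partial sums is constant beyond A. *)
Lemma csum_fin b (A : {fset J}) : (forall j, j \notin A -> b j = 0) ->
  csum b = \sum_(j <- A) b j.
Proof.
move=> b0; apply/esym; apply: csum_unique.
  by rewrite (fin_supp_mass b0) ltry.
apply: cvg_near_cst; exists A => //= B AB.
rewrite /partial_sum -(big_seq_fsetE _ B xpredT b)/=.
rewrite (big_fsetID _ (mem A) B)/= [X in _ + X]big1_fset ?addr0.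
  apply: eq_fbigl => x; rewrite !inE/=.
  by case: (boolP (x \in A)) => [/(fsubsetP AB)->|]; rewrite ?andbF.
by move=> j; rewrite !inE/= => /andP[_ /b0->].
Qed.

End Family.

Lemma csum_exchange (J K : choiceType) (b : J -> K -> C) :
  (\esum_(j in [set: J]) mass (b j) < +oo)%E ->
  csum (fun j => csum (b j)) = csum (fun k => csum (fun j => b j k)).
Proof.
move=> boo; rewrite /csum/=; congr Complex;
  by apply: rsum_exchange boo => j k; rewrite ?nrm_Re ?nrm_Im.
Qed.

Lemma mass_exchange (J K : choiceType) (b : J -> K -> C) :
  (\esum_(j in [set: J]) mass (b j) =
   \esum_(k in [set: K]) mass (fun j => b j k))%E.
Proof. by apply: (@esumR_exchange R _ _ (fun j k => nrm (b j k))) => *; exact: nrm_ge0. Qed.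

Lemma csum_reindex (J K : choiceType) (s : J -> K) (b : K -> C) :
  injective s -> (forall k, ~ range s k -> b k = 0) ->
  csum b = csum (fun j => b (s j)).
Proof.
by move=> si b0; rewrite /csum !(rsum_reindex si)// => k /b0 ->.
Qed.

Lemma mass_reindex (J K : choiceType) (s : J -> K) (b : K -> C) :
  injective s -> (forall k, ~ range s k -> b k = 0) ->
  mass b = mass (fun j => b (s j)).
Proof.
by move=> si b0; rewrite /mass (esumR_reindex si)// => k /b0 /= ->; exact: nrm0.
Qed.

(** Removing a finite set that carries all but d of the mass leaves mass at
    most d. *)
Lemma mass_tail (J : choiceType) (b : J -> C) (d : R) :
  (mass b < +oo)%E -> 0 < d -> exists F : {fset J},
    (mass (fun j => if j \in F then 0%R else b j) <= d%:E)%E.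
Proof.
move=> boo d0; have [F FP] := esumR_approx (fun j => nrm_ge0 (b j)) boo d0.
exists F; set b' := fun j => _; apply: mass_le => A.
have /andP[_ h1] := FP (F `|` A)%fset (fsubsetUl _ _).
have /andP[h2 _] := FP F (fsubset_refl _).
have h3 : \sum_(j <- (F `|` A)%fset) nrm (b j) =
    \sum_(j <- F) nrm (b j) + \sum_(j <- (F `|` A)%fset) nrm (b' j).
  rewrite [LHS](big_fsetID _ (mem F))/= [X in _ = _ + X](big_fsetID _ (mem F))/=.
  rewrite (_ : [fset x in (F `|` A) | x \in F]%fset = F); last first.
    by apply/fsetP => x; rewrite !inE; case: (x \in F); rewrite ?andbF ?andbT.
  rewrite [X in _ = _ + (X + _)]big1_fset ?add0r.
    congr (_ + _); apply: eq_fbigr => x; rewrite !inE/= => /andP[_ xF _].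
    by rewrite /b' (negPf xF).
  by move=> x xF _; rewrite /b' xF nrm0.
have h4 : \sum_(j <- A) nrm (b' j) <= \sum_(j <- (F `|` A)%fset) nrm (b' j).
  rewrite [leRHS](big_fsetID _ (mem A))/=.
  rewrite (_ : [fset x in (F `|` A) | x \in A]%fset = A); last first.
    by apply/fsetP => x; rewrite !inE; case: (x \in A); rewrite ?andbF ?orbT.
  by rewrite lerDl sumr_ge0// => j _; exact: nrm_ge0.
move: h1 h2 h3 h4; rewrite /=; lra.
Qed.

Lemma csum_sum (J : choiceType) n (b : 'I_n -> J -> C) :
  (forall i, (mass (b i) < +oo)%E) ->
  (mass (fun j => (\sum_(i < n) b i j)%R) < +oo)%E /\
  csum (fun j => \sum_(i < n) b i j) = \sum_(i < n) csum (b i).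
Proof.
elim: n b => [|n IH] b boo.
  have b0 j : j \notin fset0 -> (\sum_(i < 0) b i j)%R = 0 by rewrite big_ord0.
  rewrite (fin_supp_mass b0) ltry (csum_fin b0) big_ord0; split=> //.
  by rewrite big_seq_fset0.
have [m1 c1] := IH (fun i => b (lift ord0 i)) (fun i => boo _).
have E j : \sum_(i < n.+1) b i j = b ord0 j + \sum_(i < n) b (lift ord0 i) j.
  by rewrite big_ord_recl.
split.
  rewrite (_ : (fun j => _) = fun j => (b ord0 j + \sum_(i < n) b (lift ord0 i) j)%R).
    by apply: le_lt_trans (massD _ _) _; rewrite lte_add_pinfty.
  exact/funext.
by rewrite (eq_csum E) csumD// c1 big_ord_recl.
Qed.

End ComplexSums.

(** * Normed algebras of absolutely convergent character series *)

Section WienerNorm.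
Variables (R : realType) (I : zmodType) (X : Type) (e : I -> X -> Cplx R).
Local Notation C := (Cplx R).
Implicit Types (D P : set I) (f g : X -> C) (a b : I -> C).

(** What the solenoid and the circle have in common: a group of unimodular
    characters whose absolutely convergent series determine their
    coefficients.  Taking this as an interface gives all Banach algebra
    arguments once for both. *)
Record characters : Prop := Characters {
  char_add : forall i j x, e (i + j) x = e i x * e j x;
  char_nrm : forall i x, nrm (e i x) = 1;
  char_indep : forall a, (mass a < +oo)%E ->
    (forall x, csum (fun i => a i * e i x) = 0) -> forall i, a i = 0 }.

(** The function lies in the Wiener algebra with frequencies in D and norm at
    most c.  Carrying the bound in the predicate avoids a normed algebra
    structure: completeness becomes [wiener_le_series]. *)
Definition wiener_le D (c : R) f : Prop :=
  exists a, [/\ (mass a <= c%:E)%E, forall i, ~ D i -> a i = 0 &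
                forall x, f x = csum (fun i => a i * e i x)].

Hypothesis He : characters.

Lemma char0 x : e 0 x = 1.
Proof.
have e0 : e 0 x != 0.
  by apply/eqP => e0; have := char_nrm He 0 x; rewrite e0 nrm0; lra.
by apply: (mulfI e0); rewrite -char_add // addr0 mulr1.
Qed.

Lemma mass_char a x : mass (fun i => a i * e i x) = mass a.
Proof. by apply: eq_esum => i _; rewrite /= nrmM (char_nrm He) mulr1. Qed.

Lemma has_expansionE a f : has_expansion e a f <->
  (mass a < +oo)%E /\ forall x, f x = csum (fun i => a i * e i x).
Proof.
rewrite /has_expansion summable_mass; split=> -[aoo af]; split=> // x.
  by apply: csum_unique (af x); rewrite mass_char.
by rewrite af; apply: csum_cvg; rewrite mass_char.
Qed.

Lemma wienerP D f : wiener e D f <-> exists c, wiener_le D c f.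
Proof.
split=> [[a /has_expansionE[aoo af] a0]|[c [a [ac a0 af]]]].
  exists (fine (mass a)), a; split=> //; rewrite fineK// fin_numElt aoo andbT.
  by rewrite (lt_le_trans (ltNyr 0))// mass_ge0.
exists a => //; apply/has_expansionE; split=> //.
exact: le_lt_trans ac (ltry _).
Qed.

Lemma wiener_le_sub D D' (c c' : R) f : D `<=` D' -> c <= c' ->
  wiener_le D c f -> wiener_le D' c' f.
Proof.
move=> DD' cc' [a [ac a0 af]]; exists a; split=> //.
  by apply: le_trans ac _; rewrite lee_fin.
by move=> i Di; apply: a0 => /DD'.
Qed.

Lemma wiener_le_ge0 D c f : wiener_le D c f -> 0 <= c.
Proof. by case=> a [ac _ _]; rewrite -lee_fin; apply: le_trans (mass_ge0 a) ac. Qed.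

Lemma wiener_le_eval D c f x : wiener_le D c f -> nrm (f x) <= c.
Proof. by case=> a [ac _ ->]; apply: csum_norm; rewrite mass_char. Qed.

Lemma wiener_leD D c c' f g : wiener_le D c f -> wiener_le D c' g ->
  wiener_le D (c + c') (fun x => f x + g x).
Proof.
move=> [a [ac a0 af]] [b [bc b0 bg]]; exists (fun i => a i + b i); split.
- by apply: le_trans (massD _ _) _; rewrite EFinD; apply: leeD.
- by move=> i Di; rewrite a0// b0// addr0.
- move=> x; rewrite af bg -csumD ?mass_char.
  + by apply: eq_csum => i; rewrite mulrDl.
  + exact: le_lt_trans ac (ltry _).
  + exact: le_lt_trans bc (ltry _).
Qed.

Lemma wiener_leZ D c (z : C) f : wiener_le D c f ->
  wiener_le D (nrm z * c) (fun x => z * f x).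
Proof.
move=> [a [ac a0 af]]; have aoo := le_lt_trans ac (ltry _).
exists (fun i => z * a i); split.
- rewrite massZ// lee_fin ler_wpM2l ?nrm_ge0// -lee_fin fineK//.
  by rewrite fin_numElt aoo (lt_le_trans (ltNyr 0))// mass_ge0.
- by move=> i Di; rewrite a0// mulr0.
- move=> x; rewrite af -csumZ ?mass_char//.
  by apply: eq_csum => i; rewrite mulrA.
Qed.

Lemma wiener_leN D c f : wiener_le D c f -> wiener_le D c (fun x => - f x).
Proof.
move=> /(wiener_leZ (-1)); rewrite nrmN nrm1 mul1r.
by congr wiener_le; apply/funext => x; rewrite mulN1r.
Qed.

Lemma wiener_le0 D c : 0 <= c -> wiener_le D c (fun=> 0).
Proof.
move=> c0; exists (fun=> 0); split=> //.
  rewrite (@fin_supp_mass _ _ _ fset0)// big_seq_fset0.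
  by rewrite lee_fin.
move=> x; rewrite (@csum_fin _ _ _ fset0) ?big_seq_fset0// => i _.
by rewrite mul0r.
Qed.

Lemma wiener_le_monomial D i (z : C) : D i ->
  wiener_le D (nrm z) (fun x => z * e i x).
Proof.
move=> Di; exists (fun j => if j == i then z else 0); split.
- rewrite (@fin_supp_mass _ _ _ [fset i]%fset).
    by rewrite big_seq_fset1 eqxx.
  by move=> j; rewrite inE => /negPf ->.
- by move=> j; case: eqP => // -> /(_ Di).
- move=> x; rewrite (@csum_fin _ _ _ [fset i]%fset).
    by rewrite big_seq_fset1 eqxx.
  by move=> j; rewrite inE => /negPf ->; rewrite mul0r.
Qed.

Lemma wiener_le_cst D (z : C) : D 0 -> wiener_le D (nrm z) (fun=> z).
Proof.
move=> D0; have := wiener_le_monomial z D0; congr wiener_le.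
by apply/funext => x; rewrite char0 mulr1.
Qed.

Lemma wiener_le_sum D (J : Type) (s : seq J) (c : J -> R) (F : J -> X -> C) :
  (forall j, wiener_le D (c j) (F j)) ->
  wiener_le D (\sum_(j <- s) c j) (fun x => \sum_(j <- s) F j x).
Proof.
move=> WF; elim: s => [|j s IH].
  rewrite big_nil (_ : (fun _ => _) = fun=> 0); first exact: wiener_le0.
  by apply/funext => x; rewrite big_nil.
rewrite big_cons (_ : (fun _ => _) = fun x => F j x + \sum_(j <- s) F j x).
  exact: wiener_leD.
by apply/funext => x; rewrite big_cons.
Qed.

Lemma csum_le_mass (J : choiceType) (b : J -> C) :
  ((nrm (csum b))%:E <= mass b)%E.
Proof.
have [boo|] := boolP (mass b < +oo)%E; last by rewrite -leNgt leye_eq => /eqP->; rewrite leey.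
have bE : mass b = (fine (mass b))%:E.
  by apply: esumR_fin boo => j; exact: nrm_ge0.
by rewrite bE lee_fin; apply: csum_norm; rewrite bE.
Qed.

(** The common core of products and of limits: a summable family of
    coefficient families can be added up frequency by frequency, and its
    evaluation is the sum of the evaluations. *)
Lemma mass_double (J : choiceType) (h : J -> I -> C) (M : R) :
  (\esum_(j in [set: J]) mass (h j) <= M%:E)%E ->
  (mass (fun i => csum (fun j => h j i)) <= M%:E)%E /\
  forall x, csum (fun i => csum (fun j => h j i) * e i x) =
            csum (fun j => csum (fun i => h j i * e i x)).
Proof.
move=> hM; have hM' := hM; rewrite mass_exchange in hM'; split.
  by apply: le_trans hM'; apply: le_esum => i _; exact: csum_le_mass.
move=> x; rewrite csum_exchange; last first.
  apply: le_lt_trans (ltry M); apply: le_trans hM.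
  by apply: le_esum => j _; rewrite mass_char.
apply: eq_csum => i; rewrite mulrC -csumZ; last first.
  have : esum.summable [set: I] (fun i => mass (fun j => h j i)).
    apply: le_lt_trans (ltry M); apply: le_trans hM'.
    by apply: le_esum => k _; rewrite gee0_abs// mass_ge0.
  by move=> /summable_pinfty /(_ i Logic.I); rewrite gee0_abs// mass_ge0.
by apply: eq_csum => j; rewrite mulrC.
Qed.

(** Cauchy product: the coefficients a_i b_(k - i), indexed by i and k, form a
    double family whose inner sums over k are translates of b. *)
Lemma wiener_leM D D' D'' c c' f g :
  (forall i j, D i -> D' j -> D'' (i + j)) ->
  wiener_le D c f -> wiener_le D' c' g ->
  wiener_le D'' (c * c') (fun x => f x * g x).
Proof.
move=> DD [a [ac a0 af]] [b [bc b0 bg]].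
have aoo := le_lt_trans ac (ltry _).
have boo := le_lt_trans bc (ltry _).
have aE : mass a = (fine (mass a))%:E.
  by apply: esumR_fin aoo => j; exact: nrm_ge0.
have bE : mass b = (fine (mass b))%:E.
  by apply: esumR_fin boo => j; exact: nrm_ge0.
have shift (i : I) : injective (fun k : I => k - i) by move=> k l /addIr.
have shiftT (i k : I) : ~ range (fun k : I => k - i) k -> False.
  by apply; exists (k + i); rewrite ?addrK.
have bi i : mass (fun k => b (k - i)) = mass b.
  by rewrite -(mass_reindex (shift i))// => k /shiftT.
pose h i k := a i * b (k - i).
have hM : (\esum_(i in [set: I]) mass (h i) <= (c * c')%:E)%E.
  apply: (@le_trans _ _ (mass (fun i => (fine (mass b))%:C%C * a i))).
    apply: le_esum => i _; rewrite /= massZ ?bi// lee_fin nrmM mulrC ler_wpM2r ?nrm_ge0//.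
    by rewrite -lecR -normr_nrm ger0_norm// ler0c fine_ge0// mass_ge0.
  have nb : nrm (fine (mass b))%:C%C = fine (mass b).
    by apply: complexI; rewrite -normr_nrm ger0_norm// ler0c fine_ge0// mass_ge0.
  rewrite massZ// nb lee_fin mulrC; apply: ler_pM.
  - by rewrite fine_ge0// mass_ge0.
  - by rewrite fine_ge0// mass_ge0.
  - by rewrite -lee_fin -aE.
  - by rewrite -lee_fin -bE.
have [h1 h2] := mass_double hM.
exists (fun k => csum (fun i => h i k)); split=> //.
  move=> k Dk; rewrite (@csum_fin _ _ _ fset0) ?big_seq_fset0// => i _.
  rewrite /h; have [Di|Di] := pselect (D i); last by rewrite a0// mul0r.
  rewrite b0 ?mulr0// => D'i; apply: Dk.
  by rewrite -(subrKC i k); apply: DD.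
move=> x; rewrite h2 af bg mulrC -csumZ ?mass_char//.
apply: eq_csum => i; rewrite mulrC.
transitivity (csum (fun k => (a i * e i x) * (b (k - i) * e (k - i) x))).
  rewrite csumZ.
    rewrite -(csum_reindex (b := fun k => b k * e k x) (shift i))//.
    by move=> k /shiftT.
  rewrite -(mass_reindex (b := fun k => b k * e k x) (shift i)) ?mass_char//.
  by move=> k /shiftT.
apply: eq_csum => k; rewrite /h -[in e k x](subrKC i k) (char_add He); ring.
Qed.

(** Completeness of the Wiener algebra. *)
Lemma wiener_le_csum D (c : nat -> R) (M : R) (f : nat -> X -> C) :
  (forall j, wiener_le D (c j) (f j)) -> (esumR c <= M%:E)%E ->
  wiener_le D M (fun x => csum (fun j => f j x)).
Proof.
move=> /choice[a Wa] cM.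
have hM : (\esum_(j in [set: nat]) mass (a j) <= M%:E)%E.
  by apply: le_trans cM; apply: le_esum => j _; have [] := Wa j.
have [h1 h2] := mass_double hM.
exists (fun i => csum (fun j => a j i)); split=> //.
  move=> i Di; rewrite (@csum_fin _ _ _ fset0) ?big_seq_fset0// => j _.
  by have [_ + _] := Wa j; apply.
by move=> x; rewrite h2; apply: eq_csum => j; have [_ _ ->] := Wa j.
Qed.

(** Each finite set of indices lies below some n, and the sum below n falls
    short of the geometric tail by a nonnegative term. *)
Lemma esumR_geometric (c r : R) m : 0 <= c -> 0 <= r < 1 ->
  (esumR (fun j => if (m <= j)%N then (c * r ^+ j)%R else 0%R) <=
   (c * r ^+ m / (1 - r))%:E)%E.
Proof.
move=> c0 /andP[r0 r1]; set u := fun j => _.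
have u0 j : 0 <= u j by rewrite /u; case: ifP => // _; rewrite mulr_ge0 ?exprn_ge0.
have r1' : 1 - r != 0 by rewrite subr_eq0 eq_sym lt_eqF.
have sumu n : \sum_(j < n) u j + c * r ^+ maxn n m / (1 - r) = c * r ^+ m / (1 - r).
  elim: n => [|n IH]; first by rewrite big_ord0 add0r max0n.
  rewrite -IH big_ord_recr/= /u; case: leqP => nm.
    rewrite (maxn_idPl (leqW nm)) exprS; field.
    by rewrite -unfold_in subr_eq0 eq_sym lt_eqF.
  by rewrite addr0 (maxn_idPr nm).
apply: esumR_le => A.
pose n := (\max_(k <- A) k).+1.
apply: (@le_trans _ _ (\sum_(j < n) u j)); last first.
  rewrite -(sumu n) lerDl divr_ge0 ?mulr_ge0 ?exprn_ge0//.
  by rewrite subr_ge0 ltW.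
rewrite -lee_fin -!sumEFin -(big_mkord xpredT (fun j => (u j)%:E)).
apply: (@lee_sum_fset_nat _ (fun j => (u j)%:E) A n xpredT) => [i _|k kA /=].
  by rewrite lee_fin.
rewrite /n ltnS; move: kA => /=; rewrite big_seq_fsetE/= => kA.
by have := @leq_bigmax _ (fun k : A => val k) [` kA]%fset.
Qed.

(** Geometric convergence; the bound on every remainder is what identifies the
    limit afterwards. *)
Lemma wiener_le_series D (c r : R) (f : nat -> X -> C) : 0 <= r < 1 ->
  (forall j, wiener_le D (c * r ^+ j) (f j)) ->
  exists s, forall m,
    wiener_le D (c * r ^+ m / (1 - r)) (fun x => s x - \sum_(j < m) f j x).
Proof.
move=> r01 Wf; have c0 : 0 <= c by have := wiener_le_ge0 (Wf 0%N); rewrite mulr1.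
exists (fun x => csum (fun j => f j x)) => m.
pose c' j := if (m <= j)%N then c * r ^+ j else 0%R.
pose f' j x := if (m <= j)%N then f j x else 0.
have Wf' j : wiener_le D (c' j) (f' j).
  by rewrite /c' /f'; case: ifP => // _; exact: wiener_le0.
have := wiener_le_csum Wf' (esumR_geometric m c0 r01).
congr wiener_le; apply/funext => x.
pose A := [fset j in iota 0 m]%fset.
pose g j := if (m <= j)%N then 0 else f j x.
have gA j : j \notin A -> g j = 0.
  by rewrite /g inE mem_iota add0n/=; case: leqP.
have gE : csum g = \sum_(j < m) f j x.
  have pA : perm_eq A (iota 0 m).
    by apply: uniq_perm (fset_uniq _) (iota_uniq _ _) _ => j; rewrite !inE.
  rewrite (csum_fin gA) (perm_big _ pA)/=.
  rewrite -(big_mkord xpredT (fun j => f j x)) /index_iota subn0.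
  rewrite big_seq [RHS]big_seq; apply: eq_bigr => j; rewrite mem_iota add0n/= /g.
  by case: leqP.
have f'oo : (mass (fun j => f' j x) < +oo)%E.
  apply: le_lt_trans (ltry _); apply: le_trans (esumR_geometric m c0 r01).
  by apply: le_esumR => j; exact: wiener_le_eval (Wf' j).
have goo : (mass g < +oo)%E by rewrite (fin_supp_mass gA) ltry.
rewrite -gE; apply: (addIr (csum g)); rewrite subrK -csumD//.
by apply: eq_csum => j; rewrite /f' /g; case: leqP; rewrite ?addr0 ?add0r.
Qed.

(** Trigonometric polynomials are dense, with no new frequencies. *)
Lemma wiener_le_approx D c f (d : R) : wiener_le D c f -> 0 < d ->
  exists (F : {fset I}) p, [/\ [set` F] `<=` D, wiener_le [set` F] c p &
    wiener_le D d (fun x => f x - p x)].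
Proof.
move=> [a [ac a0 af]] d0; have aoo := le_lt_trans ac (ltry _).
have [F0 F0P] := mass_tail aoo d0.
pose F := [fset i in F0 | `[< D i >]]%fset.
pose b i := if i \in F then a i else 0.
pose b' i := if i \in F then 0 else a i.
have bF i : i \notin F -> b i = 0 by rewrite /b => /negPf->.
have boo : (mass b < +oo)%E by rewrite (fin_supp_mass bF) ltry.
have b'd : (mass b' <= d%:E)%E.
  rewrite (_ : b' = fun i => if i \in F0 then 0 else a i)//.
  apply/funext => i; rewrite /b' !inE/=; case: (i \in F0) => //=.
  by case: asboolP => // /a0.
exists F, (fun x => csum (fun i => b i * e i x)); split.
- by move=> i /=; rewrite !inE/= => /andP[_ /asboolP].
- exists b; split=> //.
    apply: le_trans ac; apply: le_esumR => i.
    by rewrite /b/=; case: ifP; rewrite ?nrm0 ?nrm_ge0.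
  by move=> i /= iF; apply: bF; apply/negP.
- exists b'; split=> //.
    by move=> i /a0; rewrite /b' => ->; case: ifP.
  move=> x; rewrite af; apply/eqP; rewrite subr_eq -csumD ?mass_char//; last first.
    exact: le_lt_trans b'd (ltry _).
  apply/eqP/eq_csum => i; rewrite /b /b'.
  by case: ifP; rewrite mul0r ?addr0 ?add0r.
Qed.

Lemma char_coef_unique a b : (mass a < +oo)%E -> (mass b < +oo)%E ->
  (forall x, csum (fun i => a i * e i x) = csum (fun i => b i * e i x)) ->
  a = b.
Proof.
move=> aoo boo ab; apply/funext => i; apply/eqP; rewrite -subr_eq0; apply/eqP.
have mN : mass (fun i => -1 * b i) = mass b.
  by apply: eq_esum => k _; rewrite /= nrmM nrmN nrm1 mul1r.
apply: (char_indep He (a := fun i => a i - b i)).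
  apply: (@le_lt_trans _ _ (mass a + mass b)%E); last by rewrite lte_add_pinfty.
  rewrite -mN; apply: le_trans (massD _ _).
  by apply: le_esumR => k /=; rewrite mulN1r.
move=> x; transitivity (csum (fun i => a i * e i x + (-1) * (b i * e i x))).
  by apply: eq_csum => k; rewrite mulN1r mulrBl.
rewrite csumD ?csumZ ?mass_char//; first by rewrite ab mulN1r subrr.
rewrite (_ : mass _ = mass b)//; apply: eq_esum => k _.
by rewrite /= !nrmM nrmN nrm1 (char_nrm He) mul1r mulr1.
Qed.

(** The coefficients of f for the two bounds coincide, so they vanish outside
    either set. *)
Lemma wiener_leI D D' c c' f :
  wiener_le D c f -> wiener_le D' c' f -> wiener_le (D `&` D') c f.
Proof.
move=> [a [ac a0 af]] [b [bc b0 bf]]; exists a; split=> // i.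
have ab : a = b.
  apply: char_coef_unique (le_lt_trans ac (ltry _)) (le_lt_trans bc (ltry _)) _.
  by move=> x; rewrite -af -bf.
move=> DD; have [Di|/a0//] := pselect (D i).
by rewrite ab; apply: b0 => D'i; apply: DD.
Qed.

Definition fcoef f : I -> C :=
  xget (fun=> 0)
    [set a | (mass a < +oo)%E /\ forall x, f x = csum (fun i => a i * e i x)].

(** On Wiener functions, the part of f with frequencies in P: [fcoef] chooses
    coefficients, and by uniqueness there is only one choice. *)
Definition wproj P f (x : X) : C :=
  csum (fun i => (if i \in P then fcoef f i else 0) * e i x).

Lemma fcoefE a f : (mass a < +oo)%E ->
  (forall x, f x = csum (fun i => a i * e i x)) -> fcoef f = a.
Proof.
move=> aoo af; rewrite /fcoef; case: xgetP => [b _ [boo bf]|/(_ a)[]//].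
by apply: char_coef_unique => // x; rewrite -af -bf.
Qed.

Lemma wiener_le_proj P D c f :
  wiener_le D c f -> wiener_le (D `&` P) c (wproj P f).
Proof.
move=> [a [ac a0 af]]; exists (fun i => if i \in P then a i else 0); split.
- apply: le_trans ac; apply: le_esumR => i /=.
  by case: ifP; rewrite ?nrm0 ?nrm_ge0.
- move=> i DP; case: ifP => // /set_mem Pi; apply: a0 => Di.
  by apply: DP.
- by move=> x; rewrite /wproj (fcoefE (le_lt_trans ac (ltry _)) af).
Qed.

Lemma wproj_split P D c f x :
  wiener_le D c f -> f x = wproj P f x + wproj (~` P) f x.
Proof.
move=> [a [ac a0 af]]; have aoo := le_lt_trans ac (ltry _).
have soo (Q : set I) : (mass (fun i => if i \in Q then a i else 0%R) < +oo)%E.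
  apply: le_lt_trans aoo; apply: le_esumR => i /=.
  by case: ifP; rewrite ?nrm0 ?nrm_ge0.
rewrite /wproj (fcoefE aoo af) -csumD ?mass_char// af.
apply: eq_csum => i; rewrite in_setC; case: (i \in P) => /=;
  by rewrite mul0r ?addr0 ?add0r.
Qed.

End WienerNorm.

(** * Matrices over the Wiener algebra and factorization near the identity *)

Section MatrixWiener.
Variables (R : realType) (I : zmodType) (X : Type) (e : I -> X -> Cplx R).
Local Notation C := (Cplx R).
Hypothesis He : characters e.
Variable n : nat.
Implicit Types (D P : set I) (g h : X -> 'M[C]_n).

(** The bound is on each entry, so a product of n by n matrices costs a factor
    n, see [mwiener_leM]. *)
Definition mwiener_le D (c : R) g : Prop :=
  forall r s, wiener_le e D c (fun x => g x r s).

Lemma mwiener_leP D g : mx_over (wiener e D) g <->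
  exists2 c, 0 <= c & mwiener_le D c g.
Proof.
split=> [Wg|[c _ cg] r s]; last by apply/(wienerP He); exists c.
have /choice[c cP] (rs : 'I_n * 'I_n) :
    exists c, wiener_le e D c (fun x => g x rs.1 rs.2).
  by apply/(wienerP He).
have c0 rs : 0 <= c rs by exact: wiener_le_ge0 (cP rs).
exists (\sum_rs c rs); first exact: sumr_ge0.
move=> r s; apply: wiener_le_sub (cP (r, s)) => //.
by rewrite (bigD1 (r, s))//= lerDl sumr_ge0.
Qed.

Lemma mwiener_le_sub D D' (c c' : R) g : D `<=` D' -> c <= c' ->
  mwiener_le D c g -> mwiener_le D' c' g.
Proof. by move=> DD cc Wg r s; apply: wiener_le_sub (Wg r s). Qed.

Lemma mwiener_leD D c c' g h : mwiener_le D c g -> mwiener_le D c' h ->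
  mwiener_le D (c + c') (fun x => g x + h x).
Proof.
move=> Wg Wh r s; have := wiener_leD He (Wg r s) (Wh r s).
by congr wiener_le; apply/funext => x; rewrite mxE.
Qed.

Lemma mwiener_leN D c g : mwiener_le D c g -> mwiener_le D c (fun x => - g x).
Proof.
move=> Wg r s; have := wiener_leN He (Wg r s).
by congr wiener_le; apply/funext => x; rewrite mxE.
Qed.

Lemma mwiener_leB D c c' g h : mwiener_le D c g -> mwiener_le D c' h ->
  mwiener_le D (c + c') (fun x => g x - h x).
Proof. by move=> Wg /mwiener_leN; exact: mwiener_leD. Qed.

Lemma mwiener_leM D D' D'' c c' g h :
  (forall i j, D i -> D' j -> D'' (i + j)) ->
  mwiener_le D c g -> mwiener_le D' c' h ->
  mwiener_le D'' (n%:R * c * c') (fun x => g x *m h x).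
Proof.
move=> DD Wg Wh r s.
have := @wiener_le_sum _ _ _ _ He D'' 'I_n (index_enum 'I_n) (fun=> c * c')
  (fun t x => g x r t * h x t s) (fun t => wiener_leM He DD (Wg r t) (Wh t s)).
rewrite sumr_const card_ord -[_ *+ n]mulr_natl mulrA.
by congr wiener_le; apply/funext => x; rewrite mxE.
Qed.

Lemma mwiener_leI D D' c c' g :
  mwiener_le D c g -> mwiener_le D' c' g -> mwiener_le (D `&` D') c g.
Proof. by move=> Wg Wg' r s; exact: wiener_leI He _ _ _ _ _ (Wg r s) (Wg' r s). Qed.

Lemma mwiener_le_cst D (A : 'M[C]_n) : D 0 ->
  exists2 c, 0 <= c & mwiener_le D c (fun=> A).
Proof.
move=> D0; apply/mwiener_leP => r s; apply/(wienerP He).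
by exists (nrm (A r s)); exact: wiener_le_cst.
Qed.

(** Values are bounded by the norm. *)
Lemma mwiener_le_eq0 g : (forall d, 0 < d -> exists D, mwiener_le D d g) ->
  forall x, g x = 0.
Proof.
move=> Wg x; apply/matrixP => r s; rewrite mxE; apply: nrm0_eq0; apply/eqP.
rewrite eq_le nrm_ge0 andbT; apply/ler_addgt0Pr => d d0; rewrite add0r.
by have [D /(_ r s)/(wiener_le_eval He)] := Wg d d0; exact.
Qed.

Lemma mwiener_le_set0 c g x : mwiener_le set0 c g -> g x = 0.
Proof.
move=> Wg; apply/matrixP => r s; rewrite mxE; have [a [_ a0 ->]] := Wg r s.
rewrite (@csum_fin _ _ _ fset0) ?big_seq_fset0// => i _.
by rewrite a0// mul0r.
Qed.

Definition mproj P g (x : X) : 'M[C]_n :=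
  \matrix_(r, s) wproj e P (fun x => g x r s) x.

Lemma mwiener_le_proj P D c g :
  mwiener_le D c g -> mwiener_le (D `&` P) c (mproj P g).
Proof.
move=> Wg r s; have := wiener_le_proj He P (Wg r s).
by congr wiener_le; apply/funext => x; rewrite mxE.
Qed.

Lemma mproj_split P D c g x :
  mwiener_le D c g -> g x = mproj P g x + mproj (~` P) g x.
Proof.
by move=> Wg; apply/matrixP => r s; rewrite !mxE; exact: wproj_split (Wg r s).
Qed.

Lemma mwiener_le_series D (c r : R) (f : nat -> X -> 'M[C]_n) : 0 <= r < 1 ->
  (forall j, mwiener_le D (c * r ^+ j) (f j)) ->
  exists s, forall m,
    mwiener_le D (c * r ^+ m / (1 - r)) (fun x => s x - \sum_(j < m) f j x).
Proof.
move=> r01 Wf.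
have /choice[s sP] (ij : 'I_n * 'I_n) : exists s : X -> C, forall m,
    wiener_le e D (c * r ^+ m / (1 - r))
      (fun x => s x - \sum_(j < m) f j x ij.1 ij.2).
  exact: (wiener_le_series He r01 (fun j => Wf j ij.1 ij.2)).
exists (fun x => \matrix_(i, j) s (i, j) x) => m i j.
have := sP (i, j) m; congr wiener_le; apply/funext => x.
by rewrite !mxE summxE.
Qed.

(** The union of the finite frequency sets of the entries serves for all of
    them. *)
Lemma mwiener_le_approx D c g (d : R) : mwiener_le D c g -> 0 < d ->
  exists (F : {fset I}) p, [/\ [set` F] `<=` D, mwiener_le [set` F] c p &
    mwiener_le D d (fun x => g x - p x)].
Proof.
move=> Wg d0.
have /choice[Fp FpP] (ij : 'I_n * 'I_n) : exists Fp : {fset I} * (X -> C),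
    [/\ [set` Fp.1] `<=` D, wiener_le e [set` Fp.1] c Fp.2 &
    wiener_le e D d (fun x => g x ij.1 ij.2 - Fp.2 x)].
  by have [F [p pP]] := wiener_le_approx He (Wg ij.1 ij.2) d0; exists (F, p).
exists (\bigcup_(ij <- enum (('I_n * 'I_n)%type : finType)) (Fp ij).1)%fset.
exists (fun x => \matrix_(i, j) (Fp (i, j)).2 x); split.
- move=> i /= /bigfcupP[ij _]; have [+ _ _] := FpP ij; exact.
- move=> i j; have [_ + _] := FpP (i, j).
  move=> /(@wiener_le_sub _ _ _ _ _
    [set` (\bigcup_(ij <- enum (('I_n * 'I_n)%type : finType)) (Fp ij).1)%fset] _ c).
  have -> : (fun x => (\matrix_(i0, j0) (Fp (i0, j0)).2 x) i j) = (Fp (i, j)).2.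
    by apply/funext => x; rewrite mxE.
  apply=> // k /= kF; apply/bigfcupP; exists (i, j) => //.
  by rewrite mem_enum.
- move=> i j; have [_ _] := FpP (i, j).
  by congr wiener_le; apply/funext => x; rewrite !mxE.
Qed.

Lemma mx_overM D D' D'' g h : (forall i j, D i -> D' j -> D'' (i + j)) ->
  mx_over (wiener e D) g -> mx_over (wiener e D') h ->
  mx_over (wiener e D'') (fun x => g x *m h x).
Proof.
move=> DD /mwiener_leP[c c0 Wg] /mwiener_leP[c' c'0 Wh]; apply/mwiener_leP.
exists (n%:R * c * c'); first by rewrite !mulr_ge0.
exact: mwiener_leM DD Wg Wh.
Qed.

Lemma GLnM D g h : (forall i j, D i -> D j -> D (i + j)) ->
  GLn (wiener e D) g -> GLn (wiener e D) h ->
  GLn (wiener e D) (fun x => g x *m h x).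
Proof.
move=> DD [g1 g2 g3] [h1 h2 h3]; split.
- exact: mx_overM DD g1 h1.
- by move=> x; rewrite unitmx_mul g2 h2.
- rewrite (_ : (fun x => _) = fun x => invmx (h x) *m invmx (g x)).
    exact: mx_overM DD h3 g3.
  apply/funext => x; have gh : g x *m h x \in unitmx by rewrite unitmx_mul g2 h2.
  apply: (can_inj (mulKmx gh)).
  by rewrite mulmxV// mulmxA (mulmxK (h2 x)) mulmxV.
Qed.

Lemma GLnV D g : GLn (wiener e D) g -> GLn (wiener e D) (fun x => invmx (g x)).
Proof.
move=> [g1 g2 g3]; split; first exact: g3.
  by move=> x; rewrite unitmx_inv; exact: g2.
have -> : (fun x => invmx (invmx (g x))) = g by apply/funext => x; rewrite invmxK.
exact: g1.
Qed.

Lemma GLn_cst D (A : 'M[C]_n) : D 0 -> A \in unitmx -> GLn (wiener e D) (fun=> A).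
Proof.
move=> D0 uA; split; last 1 first.
- by apply/mwiener_leP; exact: mwiener_le_cst.
- by apply/mwiener_leP; exact: mwiener_le_cst.
- by move=> x; exact: uA.
Qed.

Lemma GLn_right_inverse D g h : mx_over (wiener e D) g ->
  mx_over (wiener e D) h -> (forall x, g x *m h x = 1%:M) -> GLn (wiener e D) g.
Proof.
move=> Wg Wh gh; split; [exact: Wg | by move=> x; have [] := mulmx1_unit (gh x) |].
have -> : (fun x => invmx (g x)) = h; last exact: Wh.
apply/funext => x; have [u _] := mulmx1_unit (gh x).
by rewrite -[RHS]mul1mx -(mulVmx u) -mulmxA gh mulmx1.
Qed.

(** Solve by iteration: let E_0 = g, split E_k = p_k + q_k with p_k having
    frequencies in P and q_k outside P, and put E_(k+1) = - g p_k.  With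
    x = - sum p_k and y = sum q_k the partial sums satisfy
    (1 + g)(1 + x_m) = 1 + y_m + E_m, and E_m tends to 0 geometrically.  When
    P is everything, y = 0 and this is the Neumann series. *)
Lemma wiener_factor_step D P (c : R) g :
  (forall i j, D i -> D j -> D (i + j)) ->
  mwiener_le D c g -> n%:R * c < 1 ->
  exists x y, [/\ mwiener_le (D `&` P) (c / (1 - n%:R * c)) x,
    mwiener_le (D `&` ~` P) (c / (1 - n%:R * c)) y &
    forall t, (1%:M + g t) *m (1%:M + x t) = 1%:M + y t].
Proof.
move=> DD Wg nc1.
have [n0|n0] := posnP n.
  have noI (i : 'I_n) : False by have := ltn_ord i; rewrite [X in (_ < X)%N]n0.
  by exists (fun=> 0), (fun=> 0); split=> [r|r|t]; try apply/matrixP => r; case: (noI r).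
have c0 : 0 <= c by exact: wiener_le_ge0 (Wg (Ordinal n0) (Ordinal n0)).
set r := n%:R * c in nc1 *.
have r0 : 0 <= r by rewrite mulr_ge0.
have r01 : 0 <= r < 1 by rewrite r0 nc1.
pose E k := iter k (fun h x => - (g x *m mproj P h x)) g.
have ES k x : E k.+1 x = - (g x *m mproj P (E k) x) by [].
have WE k : mwiener_le D (c * r ^+ k) (E k).
  elim: k => [|k IH]; first by rewrite mulr1.
  have Wp : mwiener_le D (c * r ^+ k) (mproj P (E k)).
    by apply: mwiener_le_sub (mwiener_le_proj P IH) => // i [].
  have := mwiener_leN (mwiener_leM DD Wg Wp).
  by rewrite -/r exprS mulrCA.
have Wd k := mwiener_le_proj P (WE k).
have Wn k := mwiener_le_proj (~` P) (WE k).
have [x xP] := mwiener_le_series r01 Wd.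
have [y yP] := mwiener_le_series r01 Wn.
exists (fun t => - x t), y; split.
- apply: mwiener_leN; have := xP 0%N; rewrite mulr1.
  by congr mwiener_le; apply/funext => t; rewrite big_ord0 subr0.
- have := yP 0%N; rewrite mulr1.
  by congr mwiener_le; apply/funext => t; rewrite big_ord0 subr0.
move=> t0; apply/eqP; rewrite -subr_eq0; apply/eqP.
move: t0; apply: mwiener_le_eq0 => d d0.
(* the defect of the equation has norm at most K r^m for every m *)
pose K := c / (1 - r) + r * (c / (1 - r)) + c / (1 - r) + c.
have K0 : 0 <= K.
  have : 0 <= c / (1 - r) by rewrite divr_ge0// subr_ge0 ltW.
  by move=> h; rewrite /K !addr_ge0// mulr_ge0.
have [m Km] : exists m, K * r ^+ m <= d.
  have [K00|Kn] := eqVneq K 0; first by exists 0%N; rewrite K00 mul0r ltW.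
  have Kp : 0 < K by rewrite lt_neqAle eq_sym Kn.
  have rn : `|r| < 1 by rewrite ger0_norm.
  have /cvgrPdist_lt/(_ (d / K)) := cvg_expr rn.
  rewrite divr_gt0// => /(_ isT)[m _ /(_ m (leqnn m))] /=.
  rewrite sub0r normrN ger0_norm ?exprn_ge0// => h.
  by exists m; rewrite mulrC -ler_pdivlMr// ltW.
exists D; apply: (mwiener_le_sub (@subset_refl _ D) Km).
have W1 : mwiener_le D (c * r ^+ m / (1 - r)) (fun t => x t - \sum_(j < m) mproj P (E j) t).
  by apply: mwiener_le_sub (xP m) => // i [].
have W2 : mwiener_le D (c * r ^+ m / (1 - r)) (fun t => y t - \sum_(j < m) mproj (~` P) (E j) t).
  by apply: mwiener_le_sub (yP m) => // i [].
have W3 := mwiener_leM DD Wg W1.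
have := mwiener_leD (mwiener_leB (mwiener_leN (mwiener_leD W1 W3)) W2) (WE m).
have -> : K * r ^+ m = c * r ^+ m / (1 - r) + n%:R * c * (c * r ^+ m / (1 - r)) +
   c * r ^+ m / (1 - r) + c * r ^+ m by rewrite /K -/r; ring.
congr mwiener_le; apply/funext => t.
(* telescoping: E_(k+1) = - g p_k *)
have tele : \sum_(j < m) mproj P (E j) t + \sum_(j < m) mproj (~` P) (E j) t +
    E m t = g t - g t *m \sum_(j < m) mproj P (E j) t.
  elim: (m) => [|k IH]; first by rewrite !big_ord0 mulmx0 subr0 !add0r.
  rewrite !big_ord_recr/= mulmxDr opprD (addrA (g t)) -IH.
  rewrite (mproj_split P t (WE k)).
  move: (\sum_(j < k) mproj P (E j) t) => S1.
  move: (\sum_(j < k) mproj (~` P) (E j) t) => S2.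
  move: (mproj P (E k) t) (mproj (~` P) (E k) t) => p q.
  by move: (g t *m p) => gp; apply/matrixP => i j; rewrite !mxE; ring.
move: tele; set A := \sum_(j < m) mproj P (E j) t; set B := \sum_(j < m) mproj (~` P) (E j) t.
move=> /(congr1 (fun Z => Z - (A + B))); rewrite addrAC subrr add0r => ->.
rewrite mulmxDl !mulmxDr !mul1mx mulmx1 !mulmxN.
move: (g t *m x t) (g t *m A) => gx gA; apply/matrixP => i j; rewrite !mxE; ring.
Qed.

Lemma neumann D (c : R) g : D 0 -> (forall i j, D i -> D j -> D (i + j)) ->
  mwiener_le D c g -> n%:R * c < 1 -> GLn (wiener e D) (fun x => 1%:M + g x).
Proof.
move=> D0 DD Wg nc.
have [x [y [Wx Wy xy]]] := wiener_factor_step setT DD Wg nc.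
have one : mx_over (wiener e D) (fun=> 1%:M : 'M[C]_n).
  by apply/mwiener_leP; exact: mwiener_le_cst.
have addW h c' : mwiener_le D c' h -> mx_over (wiener e D) (fun x => 1%:M + h x).
  move=> Wh; have [c1 _ W1] := mwiener_le_cst 1%:M D0.
  have := mwiener_leD W1 Wh => W r s; apply/(wienerP He).
  by exists (c1 + c'); exact: W.
apply: GLn_right_inverse (addW _ _ Wg) (addW x _ _) _.
  by apply: mwiener_le_sub Wx => // i [].
move=> t; rewrite xy; rewrite (_ : y t = 0) ?addr0//.
by apply: mwiener_le_set0; move: Wy; rewrite setCT setI0; exact.
Qed.

(** Take x with frequencies in Dm and y outside Dm, hence in Dp; both are small,
    so 1 + x and 1 + y are invertible in their algebras. *)
Lemma wiener_factor_small (Dp Dm : set I) (c : R) g :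
  Dp 0 -> Dm 0 -> (forall i j, Dp i -> Dp j -> Dp (i + j)) ->
  (forall i j, Dm i -> Dm j -> Dm (i + j)) -> ~` Dm `<=` Dp ->
  mwiener_le setT c g -> n%:R * c <= 4^-1 ->
  exists hp hm, [/\ GLn (wiener e Dp) hp, GLn (wiener e Dm) hm &
    forall x, 1%:M + g x = hp x *m hm x].
Proof.
move=> p0 m0 pD mD pm Wg nc.
have nc1 : n%:R * c < 1 by apply: le_lt_trans nc _; lra.
have [x [y [Wx Wy xy]]] := wiener_factor_step Dm (fun _ _ _ _ => Logic.I) Wg nc1.
have small : n%:R * (c / (1 - n%:R * c)) < 1.
  by rewrite mulrA ltr_pdivrMr; lra.
have Gx : GLn (wiener e Dm) (fun t => 1%:M + x t).
  apply: neumann small => //.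
  by apply: mwiener_le_sub Wx => // i [].
have Gy : GLn (wiener e Dp) (fun t => 1%:M + y t).
  apply: neumann small => //.
  by apply: mwiener_le_sub Wy => // i [_ /pm].
exists (fun t => 1%:M + y t), (fun t => invmx (1%:M + x t)); split.
- exact: Gy.
- exact: GLnV.
by move=> t; rewrite -xy mulmxK//; case: Gx.
Qed.

End MatrixWiener.

(** * Points and characters of the solenoid *)

Section Solenoid.
Variable R : realType.
Local Notation C := (Cplx R).
Implicit Types (x t : solenoid R) (z : circle R) (N M : pint).

Definition Circle (u : C) (hu : `|u| == 1) : circle R :=
  exist (fun z : C => is_true (`|z| == 1)) u hu.

Lemma val_circle_norm z : `|val z| = 1. Proof. exact/eqP/(valP z). Qed.

Lemma circleX_subproof z j : `|val z ^+ j| == 1.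
Proof. by rewrite normrX val_circle_norm expr1n. Qed.

Definition circleX z j : circle R := Circle (circleX_subproof z j).

Lemma solenoidX_subproof x j N M : (val N %| val M)%N ->
  val (circleX (proj x N) j) = val (circleX (proj x M) j) ^+ (val M %/ val N).
Proof. by move=> NM; rewrite /= (proj_compat x NM) -!exprM mulnC. Qed.

Definition solenoidX x j : solenoid R := Solenoid (@solenoidX_subproof x j).

Lemma chi_solenoidX q x j : chi q (solenoidX x j) = chi q x ^+ j.
Proof. by rewrite /chi /zpow /= !exprnP !exprz_exp mulrC. Qed.

Lemma pintM_subproof N M : (0 < val N * val M)%N.
Proof. by rewrite muln_gt0 (valP N) (valP M). Qed.

Definition pintM N M : pint := exist (fun n => is_true (0 < n)%N) _ (pintM_subproof N M).

Lemma chiD p q x : chi (p + q) x = chi p x * chi q x.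
Proof.
pose M := pintM (denom p) (denom q).
have absE (r : rat) : (val (denom r))%:R = (denq r)%:~R :> rat.
  by rewrite /= pmulrn absz_denq.
have pE : p = (numq p * denq q)%:~R / (val M)%:R.
  rewrite natrM !absE rmorphM/= -{1}(divq_num_den p); field.
  by rewrite !intr_eq0 !denq_neq0.
have qE : q = (numq q * denq p)%:~R / (val M)%:R.
  rewrite natrM !absE rmorphM/= -{1}(divq_num_den q); field.
  by rewrite !intr_eq0 !denq_neq0.
have pqE : p + q = (numq p * denq q + numq q * denq p)%:~R / (val M)%:R.
  by rewrite rmorphD/= mulrDl -pE -qE.
by rewrite pqE {3}pE {4}qE !chiE /zpow expfzDr// circle_neq0.
Qed.

Lemma nrm_zpow k z : nrm (zpow k z) = 1.
Proof.
apply: complexI; rewrite -normr_nrm /zpow.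
case: k => j; rewrite ?NegzE /exprz/= ?normfV normrX val_circle_norm expr1n//.
by rewrite invr1.
Qed.

Lemma nrm_chi q x : nrm (chi q x) = 1.
Proof. exact: nrm_zpow. Qed.

Lemma dvdn_fact_le m n : (m <= n)%N -> (m`! %| n`!)%N.
Proof. by move=> mn; rewrite -(bin_fact mn) mulnCA dvdn_mulr. Qed.

Section Lift.
Variables (N : pint) (z : circle R).

(** A compatible system of roots of z: its k-th member sits at level N k!, and
    every level divides one of these. *)
Fixpoint lift_root (k : nat) : C :=
  if k is j.+1 then j.+1.-root (lift_root j) else val z.

Lemma lift_root_norm k : `|lift_root k| = 1.
Proof.
elim: k => [|k IH]; first exact: val_circle_norm.
by apply/eqP; rewrite -(@pexpr_eq1 _ _ k.+1)// -normrX rootCK// IH.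
Qed.

Lemma lift_rootX k m : lift_root k = lift_root (k + m) ^+ ((k + m)`! %/ k`!).
Proof.
elim: m => [|m IH]; first by rewrite addn0 divnn fact_gt0.
rewrite {1}IH addnS factS -muln_divA; last by rewrite dvdn_fact_le ?leq_addr.
by rewrite exprM /= rootCK.
Qed.

Lemma lift_subproof (M : pint) :
  `|lift_root (val M) ^+ (val N * (val M)`! %/ val M)| == 1.
Proof. by rewrite normrX lift_root_norm expr1n. Qed.

(** Level M divides level N M!, where [lift_root] gives a value. *)
Definition lift_proj (M : pint) : circle R := Circle (lift_subproof M).

Lemma lift_compat (M1 M2 : pint) : (val M1 %| val M2)%N ->
  val (lift_proj M1) = val (lift_proj M2) ^+ (val M2 %/ val M1).
Proof.
move=> M12; rewrite /= -exprM.
have le12 : (val M1 <= val M2)%N by apply: dvdn_leq M12; exact: (valP M2).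
rewrite (lift_rootX (val M1) (val M2 - val M1)) subnKC// -exprM; congr (_ ^+ _).
have M10 : (0 < val M1)%N := valP M1.
have M20 : (0 < val M2)%N := valP M2.
have d1 : (val M1 %| (val M1)`!)%N by rewrite dvdn_fact// M10 leqnn.
have d2 : (val M2 %| (val M2)`!)%N by rewrite dvdn_fact// M20 leqnn.
have d12 : ((val M1)`! %| (val M2)`!)%N by rewrite dvdn_fact_le.
apply/eqP; rewrite -(eqn_pmul2r M10).
rewrite -mulnA [(_ %/ val M1 * val M1)%N]divnK ?dvdn_mull//.
rewrite -[X in _ == X]mulnA [(_ %/ val M1 * val M1)%N]divnK// divnK ?dvdn_mull//.
by rewrite mulnCA divnK.
Qed.

Definition lift_point : solenoid R := Solenoid lift_compat.

End Lift.

Lemma proj_surj N z : exists x, proj x N = z.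
Proof.
exists (lift_point N z); apply: val_inj => /=.
rewrite mulKn ?(valP N)// -[in LHS](divn1 (val N)`!).
by have := lift_rootX z 0 (val N); rewrite add0n fact0 => <-.
Qed.

(** A root u different from 1 of 1 + X + ... + X^(p-1), for a prime p larger
    than all |k|: u has order p, which divides no nonzero k in the list. *)
Lemma root_of_unity_avoiding (s : seq int) : exists (u : circle R) (p : nat),
  [/\ (0 < p)%N, val u ^+ p = 1 &
      forall k, k \in s -> k != 0 -> val u ^ k != 1].
Proof.
have [p lt_p pr_p] := prime_above (\max_(k <- s) `|k|%N).
have p1 := prime_gt1 pr_p; have p0 := prime_gt0 pr_p.
pose P : {poly C} := \poly_(i < p) 1.
have szP : size P = p by rewrite size_poly_eq ?oner_eq0.
have /closed_rootP[u ru] : size P != 1%N by rewrite szP; case: (p) p1 => [|[]].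
have sumu : \sum_(i < p) u ^+ i = 0.
  move: ru; rewrite /root /P horner_poly => /eqP h; rewrite -[RHS]h.
  by apply: eq_bigr => i _; rewrite mul1r.
have up : u ^+ p = 1 by apply/eqP; rewrite -subr_eq0 subrX1 sumu mulr0.
have u1 : u != 1.
  apply/eqP => u1; move: sumu; rewrite u1.
  under eq_bigr do rewrite expr1n.
  by rewrite sumr_const card_ord => /eqP; rewrite pnatr_eq0; case: (p) p0.
have nu : `|u| == 1 by rewrite -(@pexpr_eq1 _ _ p)// -normrX up normr1.
exists (Circle nu), p; split=> //= k ks k0.
have [m pm dm] := prim_order_exists p0 up.
have mp : m = p.
  have [_ /(_ m dm)/orP[/eqP m1|/eqP//]] := primeP pr_p.
  by move: (prim_expr_order pm) u1; rewrite m1 expr1 => ->; rewrite eqxx.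
rewrite mp in pm.
have : u ^+ `|k|%N != 1.
  rewrite -(prim_order_dvd pm); apply/negP => /dvdn_leq.
  rewrite absz_gt0 => /(_ k0); apply/negP; rewrite -ltnNge.
  apply: leq_ltn_trans lt_p; rewrite big_seq_cond.
  by rewrite (big_rem k)/= ?ks ?leq_maxl.
apply: contra => /eqP; case: (k) => j /=; first by move=> h; apply/eqP.
move=> h; have h' : (u ^+ j.+1)^-1 = 1 := h.
by apply/eqP/invr_inj; rewrite invr1.
Qed.


Lemma common_level (s : seq rat) : exists M, {in s, forall q, invZ M q}.
Proof.
elim: s => [|q s [M sM]]; first by exists (denom 0).
exists (pintM M (denom q)) => p; rewrite inE => /predU1P[->{p}|/sM[k pk]].
  exists (numq q * (val M)%:Z); rewrite natrM rmorphM/=.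
  rewrite -{1}(divq_num_den q) [X in _ / (_ * X)]pmulrn absz_denq; field.
  by rewrite intr_eq0 denq_neq0 pnatr_eq0 -lt0n (valP M).
exists (k * denq q); rewrite natrM rmorphM/= [X in _ / (_ * X)]pmulrn absz_denq pk; field.
by rewrite intr_eq0 denq_neq0 pnatr_eq0 -lt0n (valP M).
Qed.

(** Fix q0 and d > 0, and let F carry all of the mass of a except d.  A point t
    whose coordinate at a common level of F is a suitable root of unity of
    order p satisfies (1/p) sum_(j < p) chi_(q - q0)(t^j) = 0 for q in F
    other than q0; these weights w_q have modulus at most 1 and w_q0 = 1.
    Averaging the vanishing series against chi_(-q0) over the powers of t gives
    sum_q a_q w_q = 0, so |a_q0| <= d. *)
Lemma chi_indep (a : rat -> C) : (mass a < +oo)%E ->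
  (forall x, csum (fun q => a q * chi q x) = 0) -> forall q, a q = 0.
Proof.
move=> aoo a0 q0; apply: nrm0_eq0; apply/eqP; rewrite eq_le nrm_ge0 andbT.
apply/ler_addgt0Pr => d d0; rewrite add0r.
have [F FP] := mass_tail aoo d0.
have [M MP] := common_level [seq q - q0 | q <- F].
pose num (q : rat) := numq (q * (val M)%:R).
have numE q : q \in F -> q - q0 = (num (q - q0))%:~R / (val M)%:R.
  move=> qF; have [k kE] := MP _ (map_f (fun q => q - q0) qF).
  have M0 : (val M)%:R != 0 :> rat by rewrite pnatr_eq0 -lt0n (valP M).
  by rewrite /num kE mulfVK// numq_int.
have [u [p [p0 up uk]]] := root_of_unity_avoiding [seq num (q - q0) | q <- F].
have [t tu] := proj_surj M u.
have chiF q : q \in F -> q != q0 -> chi (q - q0) t != 1 /\ chi (q - q0) t ^+ p = 1.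
  move=> qF qq0; rewrite (numE q qF) chiE tu /zpow; split.
    apply: uk; first by apply/mapP; exists q.
    apply: contra_neq qq0 => h; apply/eqP; rewrite -subr_eq0 numE// h.
    by rewrite mul0r.
  by rewrite exprnP exprz_exp mulrC -exprz_exp -exprnP up exp1rz.
pose w q : C := p%:R^-1 * \sum_(j < p) chi (q - q0) t ^+ j.
have p0C : p%:R != 0 :> C by rewrite pnatr_eq0 -lt0n.
have w0 : w q0 = 1.
  rewrite /w subrr (_ : chi 0 t = 1); last by rewrite /chi /zpow /= expr0z.
  under eq_bigr do rewrite expr1n.
  by rewrite sumr_const card_ord mulVf.
have wF q : q \in F -> q != q0 -> w q = 0.
  move=> qF qq0; have [v1 vp] := chiF q qF qq0.
  apply/eqP; rewrite mulf_eq0 invr_eq0 (negPf p0C)/=.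
  have := subrX1 (chi (q - q0) t) p; rewrite vp subrr => /esym/eqP.
  by rewrite mulf_eq0 subr_eq0 (negPf v1).
have wle q : nrm (w q) <= 1.
  rewrite nrmM nrmV nrm_nat -[leRHS](mulVf (x := p%:R)) ?pnatr_eq0 -?lt0n//.
  rewrite ler_wpM2l ?invr_ge0//; apply: le_trans (le_nrm_sum _ _ _) _.
  under eq_bigr do rewrite nrmX nrm_chi expr1n.
  by rewrite sumr_const card_ord.
have moo (j : 'I_p) : (mass (fun q => a q * chi (q - q0) t ^+ j)%R < +oo)%E.
  rewrite (_ : mass _ = mass a)//; apply: eq_esum => q _.
  by rewrite /= nrmM nrmX nrm_chi expr1n mulr1.
have [soo ssum] := csum_sum moo.
have sum0 : csum (fun q => a q * w q) = 0.
  transitivity (csum (fun q => p%:R^-1 * \sum_(j < p) a q * chi (q - q0) t ^+ j)).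
    by apply: eq_csum => q; rewrite /w mulrCA big_distrr.
  rewrite csumZ// ssum big1 ?mulr0// => j _.
  transitivity (csum (fun q => chi (- q0) t ^+ j * (a q * chi q (solenoidX t j)))).
    by apply: eq_csum => q; rewrite chiD chi_solenoidX exprMn; ring.
  rewrite csumZ ?a0 ?mulr0// (_ : mass _ = mass a)//; apply: eq_esum => q _.
  by rewrite /= nrmM nrm_chi mulr1.
pose b q := if q \in F then 0 else a q.
have bw : (mass (fun q => (if q == q0 then 0 else b q * w q)%R) <= d%:E)%E.
  apply: le_trans FP; apply: le_esumR => q /=; rewrite -/(b q).
  case: eqP => _; first by rewrite nrm0 nrm_ge0.
  by rewrite nrmM ler_piMr// nrm_ge0.
have c0 q : q \notin [fset q0]%fset -> (if q == q0 then a q else 0) = 0.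
  by rewrite inE => /negPf->.
have := csum_norm bw.
have E : csum (fun q => a q * w q) =
   csum (fun q => (if q == q0 then a q else 0) + (if q == q0 then 0 else b q * w q)).
  apply: eq_csum => q; case: eqVneq => [->|qq0]; first by rewrite w0 mulr1 addr0.
  by rewrite add0r /b; case: ifP => // qF; rewrite wF// mulr0 mul0r.
move: E; rewrite sum0 csumD; last 2 first.
- by rewrite (fin_supp_mass c0) ltry.
- exact: le_lt_trans bw (ltry _).
rewrite (csum_fin c0) big_seq_fset1 eqxx => /eqP; rewrite eq_sym addrC addr_eq0.
by move=> /eqP ->; rewrite nrmN.
Qed.

Lemma chi_characters : characters (@chi R).
Proof. by split; [exact: chiD | exact: nrm_chi | exact: chi_indep]. Qed.

Section Level.
Variable N : pint.

(** The frequency of the k-th power of the coordinate at level N. *)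
Definition level (k : int) : rat := k%:~R / (val N)%:R.

Let N0 : (val N)%:R != 0 :> rat.
Proof. by rewrite pnatr_eq0 -lt0n (valP N). Qed.

Lemma level_inj : injective level.
Proof. by move=> k l /(mulIf (invr_neq0 N0))/intr_inj. Qed.

Definition level_num (q : rat) : int := numq (q * (val N)%:R).

Lemma levelK : cancel level level_num.
Proof. by move=> k; rewrite /level_num /level divfK// numq_int. Qed.

Lemma wiener_le_pullback (D : set int) (c : R) (f : circle R -> C) :
  wiener_le (@zpow R) D c f ->
  wiener_le (@chi R) (level @` D) c (fun x => f (proj x N)).
Proof.
move=> [a [ac a0 af]].
pose b q := if `[< range level q >] then a (level_num q) else 0.
have bE k : b (level k) = a k.
  by rewrite /b levelK ifT//; apply/asboolP; exists k.
have b0 q : ~ range level q -> b q = 0 by move=> h; rewrite /b ifF//; apply/asboolP.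
exists b; split.
- rewrite (mass_reindex level_inj b0) (_ : mass _ = mass a)//.
  by congr mass; apply/funext => k.
- move=> q Dq; rewrite /b; case: asboolP => // -[k _ kq].
  by apply: a0 => Dk; apply: Dq; rewrite -kq levelK in Dk *; exists k.
- move=> x; rewrite af [RHS](csum_reindex level_inj); last first.
    by move=> q /b0 ->; rewrite mul0r.
  by apply: eq_csum => k; rewrite bE chiE.
Qed.

Lemma wiener_le_descend (c : R) (f : solenoid R -> C) :
  wiener_le (@chi R) (range level) c f ->
  exists2 h, wiener_le (@zpow R) setT c h & forall x, f x = h (proj x N).
Proof.
move=> [a [ac a0 af]].
exists (fun z => csum (fun k => a (level k) * zpow k z)).
  exists (fun k => a (level k)); split=> [|k h|//]; last by case: h.
  by rewrite -(mass_reindex level_inj a0).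
move=> x; rewrite af (csum_reindex level_inj); last first.
  by move=> q /a0 ->; rewrite mul0r.
by apply: eq_csum => k; rewrite chiE.
Qed.

End Level.

(** Independence on the circle is inherited from the solenoid, of which the
    circle is a quotient. *)
Lemma zpow_characters : characters (@zpow R).
Proof.
split; [by move=> i j z; rewrite /zpow expfzDr// circle_neq0 | by move=> *; exact: nrm_zpow |].
move=> a aoo a0 k; pose N : pint := denom 0.
have h : wiener_le (@zpow R) setT (fine (mass a)) (fun z => csum (fun k => a k * zpow k z)).
  exists a; split=> [|j h|//]; last by case: h.
  rewrite fineK// fin_numElt aoo andbT.
  by rewrite (lt_le_trans (ltNyr 0))// mass_ge0.
pose b q := if `[< range (level N) q >] then a (level_num N q) else 0.
have bE j : b (level N j) = a j.
  by rewrite /b levelK ifT//; apply/asboolP; exists j.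
have b0 q : ~ range (level N) q -> b q = 0.
  by move=> hq; rewrite /b ifF//; apply/asboolP.
rewrite -bE; apply: chi_indep => [|x].
  rewrite (mass_reindex (@level_inj N) b0) (_ : mass _ = mass a)//.
  by congr mass; apply/funext => j.
rewrite (csum_reindex (@level_inj N)); last by move=> q /b0 ->; rewrite mul0r.
by rewrite -[RHS](a0 (proj x N)); apply: eq_csum => j; rewrite bE chiE.
Qed.

End Solenoid.

(** * Frequencies of the inverse, and reduction to Laurent polynomials *)

Section Reduction.
Variables (R : realType) (I : zmodType) (X : Type) (e : I -> X -> Cplx R).
Local Notation C := (Cplx R).
Hypothesis He : characters e.
Variable n : nat.
Implicit Types (D P : set I) (g h : X -> 'M[C]_n).

Lemma fourier_support_sub D g : mx_over (wiener e setT) g ->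
  fourier_support e g `<=` D <-> mx_over (wiener e D) g.
Proof.
move=> Wg; split=> [sD|WD].
  have /choice[a aP] (rs : 'I_n * 'I_n) :
      exists a, has_expansion e a (fun x => g x rs.1 rs.2).
    by have [a ? _] := Wg rs.1 rs.2; exists a.
  move=> r s; exists (a (r, s)); first exact: aP (r, s).
  move=> i Di; apply/eqP; apply: contra_notT Di => ai; apply: sD.
  exists (fun j => \matrix_(r, s) a (r, s) j).
    by move=> r' s'; have := aP (r', s'); congr has_expansion; apply/funext => j; rewrite mxE.
  by apply: contra ai => /eqP/matrixP/(_ r s); rewrite !mxE => ->.
move=> i [A Ag Ai]; apply: contrapT => Di; case/eqP: Ai.
apply/matrixP => r s; rewrite mxE.
have [a /(has_expansionE He)[aoo af] a0] := WD r s.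
have /(has_expansionE He)[Aoo Af] := Ag r s.
rewrite -(a0 i Di); have := char_coef_unique He Aoo aoo.
by move=> /(_ _)/(congr1 (fun u => u i)) <- // x; rewrite -af -Af.
Qed.

(** Let h = p + p' with p the part with frequencies in D.  Then g p - 1 has
    frequencies in D and equals - g p', which has none there, so g p = 1 and
    p = h. *)
Lemma mx_over_inverse_supp D g h : D 0 ->
  (forall i j, D i -> D j -> D (i + j)) ->
  (forall i j, D i -> (~` D) j -> (~` D) (i + j)) ->
  mx_over (wiener e D) g -> mx_over (wiener e setT) h ->
  (forall x, g x *m h x = 1%:M) -> mx_over (wiener e D) h.
Proof.
move=> D0 DD DN /(mwiener_leP He)[c c0 Wg] /(mwiener_leP He)[c' c'0 Wh] gh.
have W1 := mwiener_le_proj He D Wh; rewrite setTI in W1.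
have W2 := mwiener_le_proj He (~` D) Wh; rewrite setTI in W2.
have gp1 x : g x *m mproj e D h x = 1%:M.
  apply/eqP; rewrite -subr_eq0; apply/eqP.
  have [c1 _ Wc] := mwiener_le_cst He (1%:M : 'M[C]_n) D0.
  have V1 := mwiener_leB He (mwiener_leM He DD Wg W1) Wc.
  have V2 := mwiener_leN He (mwiener_leM He DN Wg W2).
  have V12 : (fun x => - (g x *m mproj e (~` D) h x)) =
             (fun x => g x *m mproj e D h x - 1%:M).
    apply/funext => y; rewrite -(gh y) (mproj_split He D y Wh) mulmxDr.
    by rewrite opprD addNKr.
  rewrite V12 in V2; have := mwiener_leI He V1 V2; rewrite setICr.
  by move=> V; exact: (mwiener_le_set0 x V).
apply/(mwiener_leP He); exists c' => //.
have -> : h = mproj e D h; last exact: W1.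
apply/funext => x; have [u _] := mulmx1_unit (gh x).
by apply: (can_inj (mulKmx u)); rewrite gh gp1.
Qed.

Section Approximate.
Variables Dp Dm : set I.
Hypotheses (p0 : Dp 0) (m0 : Dm 0) (pD : forall i j, Dp i -> Dp j -> Dp (i + j))
  (mD : forall i j, Dm i -> Dm j -> Dm (i + j)) (pm : ~` Dm `<=` Dp).

Let setT_add (i j : I) : [set: I] i -> [set: I] j -> [set: I] (i + j).
Proof. by []. Qed.

Lemma scale_small (c : R) : 0 <= c ->
  exists2 d, 0 < d & n%:R * (n%:R * c * d) <= 4^-1.
Proof.
move=> c0; pose K := n%:R * (n%:R * c) + 1.
have K0 : 0 < K by rewrite ltr_wpDl// !mulr_ge0.
exists (4 * K)^-1; first by rewrite invr_gt0 mulr_gt0.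
rewrite !mulrA ler_pdivrMr ?mulr_gt0// mulKf//.
by rewrite /K mulrA lerDl.
Qed.

(** If p is close to g then p = g (1 + u) with u = g^-1 (p - g) small, and
    [wiener_factor_small] factors 1 + u. *)
Lemma approx_right D g : GLn (wiener e setT) g -> mx_over (wiener e D) g ->
  exists (F : {fset I}) p hp hm, [/\ [set` F] `<=` D,
    mx_over (wiener e [set` F]) p, GLn (wiener e Dp) hp, GLn (wiener e Dm) hm &
    forall x, p x = g x *m hp x *m hm x].
Proof.
move=> [_ ug /(mwiener_leP He)[c c0 Wi]] /(mwiener_leP He)[c' c'0 Wg].
have [d d0 dP] := scale_small c0.
have [F [p [FD Wp Wd]]] := mwiener_le_approx He Wg d0.
have Wd' := mwiener_le_sub (@subsetT _ D) (lexx d) Wd.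
have We := mwiener_leN He (mwiener_leM He setT_add Wi Wd').
have [hp [hm [Hp Hm E]]] := wiener_factor_small He p0 m0 pD mD pm We dP.
exists F, p, hp, hm; split; [exact: FD | | exact: Hp | exact: Hm |].
  by apply/(mwiener_leP He); exists c'.
move=> x; rewrite -mulmxA -E mulmxDr mulmx1 mulmxN mulmxA (mulmxV (ug x)).
by rewrite mul1mx opprB addrC subrK.
Qed.

(** As for [approx_right], from p = (1 + u) g with u = (p - g) g^-1. *)
Lemma approx_left D g : GLn (wiener e setT) g -> mx_over (wiener e D) g ->
  exists (F : {fset I}) p hp hm, [/\ [set` F] `<=` D,
    mx_over (wiener e [set` F]) p, GLn (wiener e Dp) hp, GLn (wiener e Dm) hm &
    forall x, p x = hp x *m hm x *m g x].
Proof.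
move=> [_ ug /(mwiener_leP He)[c c0 Wi]] /(mwiener_leP He)[c' c'0 Wg].
have [d d0 dP] := scale_small c0.
have [F [p [FD Wp Wd]]] := mwiener_le_approx He Wg d0.
have Wd' := mwiener_le_sub (@subsetT _ D) (lexx d) Wd.
have We := mwiener_leN He (mwiener_leM He setT_add Wd' Wi).
have dP' : n%:R * (n%:R * d * c) <= 4^-1 by rewrite mulrAC.
have [hp [hm [Hp Hm E]]] := wiener_factor_small He p0 m0 pD mD pm We dP'.
exists F, p, hp, hm; split; [exact: FD | | exact: Hp | exact: Hm |].
  by apply/(mwiener_leP He); exists c'.
move=> x; rewrite -E mulmxDl mul1mx mulNmx -mulmxA (mulVmx (ug x)).
by rewrite mulmx1 opprB addrC subrK.
Qed.

End Approximate.

End Reduction.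

Section Laurent.
Variables (R : realType) (n : nat).
Local Notation C := (Cplx R).
Local Notation He := (zpow_characters R).

Definition Wplus : set (circle R -> C) := wiener (@zpow R) [set k | 0 <= k].
Definition Wminus : set (circle R -> C) := wiener (@zpow R) [set k | k <= 0].

Lemma fset_int_bounded (F : {fset int}) : exists m : nat,
  [set` F] `<=` [set k | - m%:Z <= k <= m%:Z].
Proof.
exists (\max_(k <- F) `|k|%N)%N => k /= kF.
have : (`|k|%N <= \max_(k <- F) `|k|%N)%N.
  by rewrite (big_rem k)//= leq_maxl.
move: (\max_(_ <- _) _)%N => M; lia.
Qed.

(** First p = g u+ u- with p a trigonometric polynomial: w = g u+ = p u-^-1 has
    frequencies bounded above.  Approximating w within these frequencies gives
    p' = a+ a- w, and a- w = a+^-1 p' has frequencies bounded above by its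
    left side and below by its right side. *)
Lemma laurent_reduction (g : circle R -> 'M[C]_n) : GLn (@Wcircle R) g ->
  exists hm hp (m : nat), [/\ GLn Wminus hm, GLn Wplus hp &
    mx_over (wiener (@zpow R) [set k | - m%:Z <= k <= m%:Z])
      (fun z => hm z *m g z *m hp z)].
Proof.
move=> Gg.
pose Dp : set int := [set k | 0 <= k]; pose Dm : set int := [set k | k <= 0].
have p0 : Dp 0 by [].
have m0 : Dm 0 by [].
have pD i j : Dp i -> Dp j -> Dp (i + j) by rewrite /Dp/=; lia.
have mD i j : Dm i -> Dm j -> Dm (i + j) by rewrite /Dm/=; lia.
have pm : ~` Dm `<=` Dp by move=> k; rewrite /Dp/Dm/=; lia.
have [Wg ug Wi] := Gg.
have [F [p [up [um [_ Wp Gp Gm pE]]]]] := approx_right He p0 m0 pD mD pm Gg Wg.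
have [m1 Fm1] := fset_int_bounded F.
pose w z := g z *m up z.
have overS (D D' : set int) (f : circle R -> 'M[C]_n) : D `<=` D' ->
    mx_over (wiener (@zpow R) D) f -> mx_over (wiener (@zpow R) D') f.
  move=> DD /(mwiener_leP He)[c c0 Wf]; apply/(mwiener_leP He); exists c => //.
  exact: mwiener_le_sub Wf.
have GLnS (D D' : set int) (f : circle R -> 'M[C]_n) : D `<=` D' ->
    GLn (wiener (@zpow R) D) f -> GLn (wiener (@zpow R) D') f.
  by move=> DD [f1 f2 f3]; split; [exact: overS f1 | exact: f2 | exact: overS f3].
have Gw : GLn (wiener (@zpow R) setT) w.
  have tT (i j : int) : [set: int] i -> [set: int] j -> [set: int] (i + j) by [].
  exact: (GLnM He tT Gg (GLnS _ _ _ (@subsetT _ _) Gp)).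
have [_ um_unit Wmi] := Gm.
have Ww : mx_over (wiener (@zpow R) [set k | k <= m1%:Z]) w.
  have -> : w = fun z => p z *m invmx (um z).
    by apply/funext => z; rewrite pE mulmxK.
  apply: (mx_overM He _ Wp Wmi) => i j /Fm1; rewrite /Dm/=; lia.
have [F' [p' [ap [am [F'D Wp' Gap Gam p'E]]]]] := approx_left He p0 m0 pD mD pm Gw Ww.
have [m2 Fm2] := fset_int_bounded F'.
exists am, up, (maxn m1 m2); split; [exact: Gam | exact: Gp |].
have [Wam _ _] := Gam; have [_ uap Wapi] := Gap.
have V1 : mx_over (wiener (@zpow R) [set k | k <= m1%:Z]) (fun z => am z *m w z).
  by apply: (mx_overM He _ Wam Ww) => i j; rewrite /Dm/=; lia.
have V2 : mx_over (wiener (@zpow R) [set k | - m2%:Z <= k]) (fun z => am z *m w z).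
  have -> : (fun z => am z *m w z) = fun z => invmx (ap z) *m p' z.
    by apply/funext => z; rewrite p'E -mulmxA mulKmx.
  by apply: (mx_overM He _ Wapi Wp') => i j + /Fm2; rewrite /Dp/=; lia.
have -> : (fun z => am z *m g z *m up z) = (fun z => am z *m w z).
  by apply/funext => z; rewrite mulmxA.
move: V1 V2 => /(mwiener_leP He)[c c0 V1] /(mwiener_leP He)[c' c'0 V2].
apply/(mwiener_leP He); exists c => //.
apply: mwiener_le_sub (mwiener_leI He V1 V2) => // k [/=]; lia.
Qed.

End Laurent.

(** * Polynomial matrices *)

Section PolyMatrix.
Variable F : closedFieldType.
Variable n : nat.
Implicit Types (q U T : 'M[{poly F}]_n).

Definition mxeval (a : F) : 'M[{poly F}]_n -> 'M[F]_n := map_mx (horner_eval a).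

Lemma det_mxeval a q : \det (mxeval a q) = (\det q).[a].
Proof. by rewrite /mxeval det_map_mx. Qed.

Lemma mxevalM a q T : mxeval a (q *m T) = mxeval a q *m mxeval a T.
Proof. exact: map_mxM. Qed.

(** Right multiplication by it replaces column j of M by M v and keeps the
    others. *)
Definition colset (A : comNzRingType) (j : 'I_n) (v : 'cV[A]_n) : 'M[A]_n :=
  \matrix_(i, l) if l == j then v i 0 else (i == l)%:R.

Lemma mulmx_colset (A : comNzRingType) (M : 'M[A]_n) j v i l :
  (M *m colset j v) i l = if l == j then (M *m v) i 0 else M i l.
Proof.
rewrite !mxE; case: eqVneq => [->|lj].
  by apply: eq_bigr => t _; rewrite !mxE eqxx.
rewrite (bigD1 l)//= big1 ?addr0 => [|t tl]; rewrite !mxE (negPf lj).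
  by rewrite eqxx mulr1.
by rewrite (negPf tl) mulr0.
Qed.

Lemma colset_unit (A : comUnitRingType) (j : 'I_n) (v : 'cV[A]_n) :
  v j 0 \is a GRing.unit -> colset j v \in unitmx.
Proof.
move=> uv; pose w : 'cV[A]_n := \col_i if i == j then (v j 0)^-1 else - (v i 0 / v j 0).
suff /mulmx1_unit[] : colset j v *m colset j w = 1%:M by [].
apply/matrixP => i l; rewrite mulmx_colset; case: eqVneq => [->|lj]; last first.
  by rewrite !mxE (negPf lj).
rewrite !mxE (bigD1 j)//= !mxE eqxx.
have [->|ij] := eqVneq i j.
  rewrite divrr// big1 ?addr0// => t tj; rewrite !mxE (negPf tj).
  by rewrite eq_sym (negPf tj) mul0r.
rewrite (bigD1 i)//= !mxE (negPf ij) eqxx mul1r big1 ?addr0 ?subrr// => t /andP[tj ti].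
by rewrite !mxE (negPf tj) eq_sym (negPf ti) mul0r.
Qed.

(** A kernel vector v of q(a), used as a new column, makes that column divisible
    by X - a.  The determinant of the quotient loses the root. *)
Lemma peel_root q (a : F) : (\det q).[a] = 0 ->
  exists q' U, [/\ q = q' *m U, exists2 c, c != 0 & \det U = c *: ('X - a%:P) &
    \det q != 0 -> (size (\det q') < size (\det q))%N].
Proof.
rewrite -det_mxeval -det_tr => /eqP/det0P[v v0 va].
have {}va : mxeval a q *m v^T = 0 by rewrite -[LHS]trmxK trmx_mul trmxK va trmx0.
have /rV0Pn[j vj] := v0.
pose T0 := colset j v^T.
have uT0 : T0 \in unitmx by apply: colset_unit; rewrite mxE unitfE.
pose T : 'M[{poly F}]_n := map_mx polyC T0.
have TV : T *m map_mx polyC (invmx T0) = 1%:M by rewrite -map_mxM mulmxV// map_mx1.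
have root_col i : root ((q *m T) i j) a.
  rewrite /root; have : mxeval a (q *m T) i j = 0.
    rewrite mxevalM (_ : mxeval a T = T0).
      by rewrite mulmx_colset eqxx va mxE.
    by apply/matrixP => k l; rewrite !mxE /horner_eval hornerC.
  by rewrite mxE => /eqP.
pose S : 'M[{poly F}]_n := diag_mx (\row_i if i == j then 'X - a%:P else 1).
pose q' : 'M[{poly F}]_n :=
  \matrix_(i, l) if l == j then (q *m T) i j %/ ('X - a%:P) else (q *m T) i l.
have qT : q *m T = q' *m S.
  apply/matrixP => i l; rewrite mul_mx_diag !mxE; case: eqVneq => [->|_].
    by rewrite divpK//; have := root_col i; rewrite root_factor_theorem mxE.
  by rewrite mulr1.
have qE : q = q' *m (S *m map_mx polyC (invmx T0)).
  by rewrite mulmxA -qT -mulmxA TV mulmx1.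
have dS : \det S = 'X - a%:P.
  rewrite det_diag (bigD1 j)//= mxE eqxx big1 ?mulr1// => i ij.
  by rewrite mxE (negPf ij).
have dU : \det (S *m map_mx polyC (invmx T0)) = \det (invmx T0) *: ('X - a%:P).
  by rewrite det_mulmx dS det_map_mx mulrC mul_polyC.
have c0 : \det (invmx T0) != 0 by rewrite -unitfE -unitmxE unitmx_inv.
exists q', (S *m map_mx polyC (invmx T0)); split=> //.
  by exists (\det (invmx T0)).
have dq : \det q = \det q' * (\det (invmx T0) *: ('X - a%:P)).
  by rewrite {1}qE det_mulmx dU.
rewrite dq => d0; have q'0 : \det q' != 0.
  by apply: contra d0 => /eqP ->; rewrite mul0r.
by rewrite -scalerAr size_scale// size_Mmonic ?monicXsubC// size_XsubC addn2.
Qed.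

(** Induction on the degree of the determinant, peeling roots in P to the right. *)
Lemma split_roots (P : pred F) q : \det q != 0 ->
  exists q' U, [/\ q = q' *m U, forall a, root (\det q') a -> ~~ P a &
    forall a, root (\det U) a -> P a].
Proof.
have [m] := ubnP (size (\det q)); elim: m q => // m IH q; rewrite ltnS => qm q0.
have [r rE] := closed_field_poly_normal (\det q).
have rootE a : root (\det q) a = (a \in r).
  by rewrite rE rootZ ?lead_coef_eq0// root_prod_XsubC.
have [/hasP[a ar Pa]|/hasPn noP] := boolP (has P r); last first.
  exists q, 1%:M; split=> [|a|a]; first by rewrite mulmx1.
    by rewrite rootE => /noP.
  by rewrite det1 rootC oner_eq0.
have qa0 : (\det q).[a] = 0 by apply/eqP; rewrite -/(root _ a) rootE.
have [q1 [U1 [qE [c c0 dU1] /(_ q0) lt1]]] := peel_root qa0.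
have q10 : \det q1 != 0.
  by apply: contra q0 => /eqP h; rewrite qE det_mulmx h mul0r.
have [q2 [U2 [q1E q2P U2P]]] := IH _ (leq_trans lt1 qm) q10.
exists q2, (U2 *m U1); split=> // [|b]; first by rewrite mulmxA -q1E.
rewrite det_mulmx rootM => /orP[/U2P//|].
by rewrite dU1 rootZ// root_XsubC => /eqP ->.
Qed.

(** Suppose the matrix L of leading coefficients, taken at the column bounds
    k_j, is singular: L v = 0.  Among the columns with v_j != 0 choose one with
    the largest bound and replace it by the combination of the columns
    X^(k_j - k_i) q_i with weights v_i.  This is unimodular, and cancels the
    leading term, so k_j drops by one.  A bound cannot drop below 0, for the
    column would vanish, and the sum of the bounds decreases. *)
Lemma column_reduce q : \det q != 0 ->
  exists T (k : 'I_n -> nat), [/\ T \in unitmx,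
    forall i j, (size ((q *m T) i j) <= (k j).+1)%N &
    \matrix_(i, j) ((q *m T) i j)`_(k j) \in unitmx].
Proof.
move=> q0; pose k0 (j : 'I_n) := \max_i size (q i j).
have k0P i j : (size (q i j) <= (k0 j).+1)%N.
  by apply: leqW; exact: (leq_bigmax (F := fun i => size (q i j)) i).
move: k0 k0P => k; have [m] := ubnP (\sum_j k j).
elim: m q q0 k => // m IH q q0 k; rewrite ltnS => km kP.
(* the sum of the column bounds is the measure of the induction *)
pose L := \matrix_(i, j) (q i j)`_(k j).
have [uL|] := boolP (L \in unitmx).
  by exists 1%:M, k; rewrite mulmx1; split; rewrite ?unitmx1.
rewrite unitmxE unitfE negbK -det_tr => /det0P[v v0 va].
have {}va : L *m v^T = 0 by rewrite -[LHS]trmxK trmx_mul trmxK va trmx0.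
have /rV0Pn[j0 vj0] := v0.
have := @arg_maxnP _ j0 (fun j => v 0 j != 0) k vj0.
case: arg_maxnP => // j vj kmax _.
pose V : 'cV[{poly F}]_n := \col_i (v 0 i *: 'X^(k j - k i)).
pose T := colset j V.
have uT : T \in unitmx.
  apply: colset_unit; rewrite mxE subnn expr0 alg_polyC.
  by rewrite poly_unitE size_polyC vj/= coefC eqxx unitfE.
have d0 : \det (q *m T) != 0.
  rewrite det_mulmx mulf_neq0//; move: uT; rewrite unitmxE.
  by apply: contraTneq => ->; rewrite unitr0.
have szj i : (size ((q *m T) i j) <= k j)%N.
  rewrite mulmx_colset eqxx; apply/leq_sizeP => t kt.
  rewrite mxE coef_sum; have [->|kt'] := eqVneq t (k j); last first.
    rewrite big1// => l _; rewrite mxE -scalerAr coefZ.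
    have [->|vl] := eqVneq (v 0 l) 0; first by rewrite mul0r.
    rewrite coefMXn; case: ifP => _; first by rewrite mulr0.
    rewrite (leq_sizeP _ _ (kP i l)) ?mulr0//.
    by have := kmax l vl; lia.
  transitivity ((L *m v^T) i 0); last by rewrite va mxE.
  rewrite mxE; apply: eq_bigr => l _; rewrite !mxE -scalerAr coefZ mulrC.
  have [->|vl] := eqVneq (v 0 l) 0; first by rewrite !mulr0.
  by rewrite coefMXn ltnNge leq_subr/= subKn//; exact: kmax.
have kj0 : (0 < k j)%N.
  rewrite lt0n; apply: contra d0 => /eqP kj; rewrite (expand_det_col _ j).
  rewrite big1// => i _; have := szj i; rewrite kj leqn0 size_poly_eq0 => /eqP ->.
  by rewrite mul0r.
pose k' l := if l == j then (k j).-1 else k l.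
have k'm : (\sum_l k' l < m)%N.
  apply: leq_trans km; rewrite (bigD1 j)//= [ltnRHS](bigD1 j)//= /k' eqxx.
  rewrite (eq_bigr k) => [|l /negPf -> //]; by rewrite -addSn prednK.
have k'P i l : (size ((q *m T) i l) <= (k' l).+1)%N.
  rewrite /k'; case: eqVneq => [->|lj]; first by rewrite prednK.
  by rewrite mulmx_colset (negPf lj).
have [T' [k'' [uT' P1 P2]]] := IH _ d0 k' k'm k'P.
by exists (T *m T'), k''; rewrite unitmx_mul uT uT' mulmxA; split.
Qed.

(** Reversing the coefficients of column j up to degree k_j is dividing by
    w^(k_j) and substituting w^-1; the value at 0 is the matrix of leading
    coefficients. *)
Lemma reverse_columns q (k : 'I_n -> nat) :
  (forall i j, (size (q i j) <= (k j).+1)%N) ->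
  \matrix_(i, j) (q i j)`_(k j) \in unitmx ->
  exists L, (forall w, w != 0 ->
      mxeval w q = mxeval w^-1 L *m diag_mx (\row_j w ^+ k j)) /\
    mxeval 0 L \in unitmx.
Proof.
move=> kP uL.
exists (\matrix_(i, j) \poly_(t < (k j).+1) (q i j)`_(k j - t)); split.
  move=> w w0; apply/matrixP => i j; rewrite mul_mx_diag !mxE /horner_eval.
  rewrite (horner_coef_wide _ (kP i j)) horner_poly mulr_suml.
  rewrite (reindex_inj rev_ord_inj)/=; apply: eq_bigr => t _.
  rewrite subSS -mulrA; congr (_ * _); rewrite exprVn.
  have tk : (t <= k j)%N := ltn_ord t.
  apply: (mulfI (expf_neq0 t w0)); rewrite -exprD subnKC// mulrA mulfV ?mul1r//.
  exact: expf_neq0.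
rewrite (_ : mxeval _ _ = \matrix_(i, j) (q i j)`_(k j))//.
apply/matrixP => i j; rewrite !mxE /horner_eval horner_coef0 coef_poly/=.
by rewrite subn0.
Qed.

End PolyMatrix.

(** * Birkhoff factorization on the circle *)

Section PolynomialLoops.
Variables (R : realType) (I : zmodType) (X : Type) (e : I -> X -> Cplx R).
Local Notation C := (Cplx R).
Hypothesis He : characters e.
Variables (D : set I) (i : I).
Hypotheses (D0 : D 0) (DD : forall j k, D j -> D k -> D (j + k)) (Di : D i).

Lemma wienerM (f g : X -> C) :
  wiener e D f -> wiener e D g -> wiener e D (fun x => f x * g x).
Proof.
move=> /(wienerP He)[c Wf] /(wienerP He)[c' Wg]; apply/(wienerP He).
exists (c * c'). have H := wiener_leM He DD Wf Wg. exact: H.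
Qed.

Lemma wiener_cst (z : C) : wiener e D (fun=> z).
Proof. by apply/(wienerP He); exists (nrm z); exact: wiener_le_cst. Qed.

Lemma wiener_horner (p : {poly C}) : wiener e D (fun x => p.[e i x]).
Proof.
elim/poly_ind: p => [|p c IH].
  have := wiener_cst 0; congr wiener; apply/funext => x.
  by rewrite horner0.
have Wi : wiener e D (fun x => e i x).
  apply/(wienerP He); exists (nrm 1); have := wiener_le_monomial e 1 Di.
  by congr wiener_le; apply/funext => x; rewrite mul1r.
have /(wienerP He)[c1 W1] := wienerM IH Wi.
have /(wienerP He)[c2 W2] := wiener_cst c.
apply/(wienerP He); exists (c1 + c2); have := wiener_leD He W1 W2.
by congr wiener_le; apply/funext => x; rewrite hornerMXaddC.
Qed.

(** Scalar Neumann series for 1 - e_i / a. *)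
Lemma wiener_inv_linear (a : C) : 1 < nrm a ->
  wiener e D (fun x => (e i x - a)^-1).
Proof.
move=> a1; have a0 : a != 0.
  by apply: contraTneq a1 => ->; rewrite nrm0 -leNgt ler01.
pose c : C := - a^-1.
have c1 : nrm c < 1.
  by rewrite nrmN nrmV invf_lt1// (lt_trans ltr01 a1).
pose g x : 'M[C]_1 := (c * e i x)%:M.
have Wg : mwiener_le e D (nrm c) g.
  move=> r s; have := wiener_le_monomial e c Di; congr wiener_le.
  by apply/funext => x; rewrite !ord1 mxE eqxx mulr1n.
have c1' : 1%:R * nrm c < 1 by rewrite mul1r.
have [_ _ /(_ 0 0) Wi] := neumann He D0 DD Wg c1'.
have := wienerM (wiener_cst c) Wi; congr wiener; apply/funext => x.
have c0 : c != 0 by rewrite oppr_eq0 invr_eq0.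
have ca : c * a = -1 by rewrite /c mulNr mulVf.
have -> : 1%:M + g x = (c * (e i x - a))%:M.
  by rewrite /g -raddfD/= mulrBr ca opprK addrC.
by rewrite invmx_scalar mxE eqxx mulr1n invfM mulrA mulfV// mul1r.
Qed.

(** Over an algebraically closed field this reduces to [wiener_inv_linear], as
    all roots have modulus larger than 1. *)
Lemma wiener_inv_horner (p : {poly C}) :
  (forall w, nrm w <= 1 -> p.[w] != 0) -> wiener e D (fun x => p.[e i x]^-1).
Proof.
move=> p0; have [r rE] := closed_field_poly_normal p.
have p1 : p != 0.
  by apply: contraTneq (p0 0 _) => [->|]; rewrite ?horner0 ?eqxx ?nrm0.
have r1 a : a \in r -> 1 < nrm a.
  move=> ar; rewrite ltNge; apply: contraTN ar => /p0; apply: contraNN => ar.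
  by rewrite -/(root _ _) rE rootZ ?lead_coef_eq0// root_prod_XsubC.
have -> : (fun x => p.[e i x]^-1) =
    (fun x => (lead_coef p)^-1 * \prod_(a <- r) (e i x - a)^-1).
  apply/funext => x; rewrite {1}rE hornerZ invfM horner_prod; congr (_ * _).
  rewrite -prodfV; apply: eq_bigr => a _.
  by rewrite hornerXsubC.
apply: wienerM; first exact: wiener_cst.
elim: r {rE} r1 => [|a r IH] r1.
  have := wiener_cst 1; congr wiener; apply/funext => x; by rewrite big_nil.
have := wienerM (wiener_inv_linear (r1 a (mem_head _ _)))
   (IH (fun b br => r1 b (mem_behead (s := a :: r) br))).
by congr wiener; apply/funext => x; rewrite big_cons.
Qed.

(** The inverse is the adjugate divided by the determinant.  With e_i = z this
    serves the disc around 0, with e_i = z^-1 the disc around infinity. *)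
Lemma GLn_mxeval n (L : 'M[{poly C}]_n) :
  (forall w, nrm w <= 1 -> (\det L).[w] != 0) ->
  GLn (wiener e D) (fun x => mxeval (e i x) L).
Proof.
move=> L0; have overL (M : 'M[{poly C}]_n) :
    mx_over (wiener e D) (fun x => mxeval (e i x) M).
  move=> r s; have := wiener_horner (M r s); congr wiener.
  by apply/funext => x; rewrite mxE.
apply: (@GLn_right_inverse _ _ _ _ _ D _
  (fun x => (\det L).[e i x]^-1 *: mxeval (e i x) (\adj L))).
- exact: overL.
- move=> r s; have := wienerM (wiener_inv_horner L0) (overL (\adj L) r s).
  by congr wiener; apply/funext => x; rewrite [RHS]mxE.
- move=> x; rewrite -scalemxAr -mxevalM mul_mx_adj.
  apply/matrixP => r s; rewrite !mxE /horner_eval hornerMn.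
  by rewrite mulrnAr mulVf// L0// (char_nrm He).
Qed.

End PolynomialLoops.

Section Birkhoff.
Variables (R : realType) (n : nat).
Local Notation C := (Cplx R).
Local Notation He := (zpow_characters R).

Lemma zpow1 (z : circle R) : zpow 1 z = val z. Proof. by rewrite /zpow expr1z. Qed.

Lemma laurent_poly (m : nat) (f : circle R -> C) :
  wiener (@zpow R) [set k | - m%:Z <= k <= m%:Z] f ->
  exists p : {poly C}, forall z : circle R, val z ^+ m * f z = p.[val z].
Proof.
move=> [a /(has_expansionE He)[_ af] a0].
pose h (i : 'I_(m + m).+1) : int := i%:Z - m%:Z.
have h_inj : injective h by move=> i j; rewrite /h => /addIr[] /val_inj.
exists (\poly_(i < (m + m).+1) a (i%:Z - m%:Z)) => z.
rewrite af (@csum_fin _ _ _ [fset h i | i in 'I_(m + m).+1]%fset); last first.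
  move=> k kA; rewrite a0 ?mul0r// => /= km; case/negP: kA.
  have lt : (absz (k + m%:Z)%R < (m + m).+1)%N by lia.
  apply/imfsetP; exists (Ordinal lt) => //; rewrite /h/=; lia.
rewrite big_imfset/=; last by move=> i j _ _; exact: h_inj.
rewrite big_enum/= horner_poly mulr_sumr; apply: eq_bigr => i _.
rewrite mulrCA; congr (_ * _); rewrite /zpow /h exprnP -expfzDr ?circle_neq0//.
by rewrite addrC subrK.
Qed.

Lemma laurent_poly_mx (m : nat) (f : circle R -> 'M[C]_n) :
  mx_over (wiener (@zpow R) [set k | - m%:Z <= k <= m%:Z]) f ->
  exists q : 'M[{poly C}]_n, forall z : circle R, val z ^+ m *: f z = mxeval (val z) q.
Proof.
move=> Wf; have /choice[p pE] (rs : 'I_n * 'I_n) : exists p : {poly C},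
    forall z : circle R, val z ^+ m * f z rs.1 rs.2 = p.[val z].
  exact: laurent_poly (Wf rs.1 rs.2).
exists (\matrix_(r, s) p (r, s)) => z; apply/matrixP => r s.
by rewrite !mxE; exact: pE (r, s) z.
Qed.

(** Write q = q1 U with the roots of det U outside the closed disc, so that U
    is in GL_n(W+), and those of det q1 inside.  After column reduction
    q1 T = L(z^-1) diag(z^(k_j)), and det L has no root in the closed unit disc:
    at 0 because the leading coefficients are invertible, elsewhere because
    det q1 has no root outside the open disc. *)
Lemma polynomial_birkhoff (q : 'M[{poly C}]_n) :
  (forall z : circle R, mxeval (val z) q \in unitmx) ->
  exists hm hp (k : 'I_n -> nat), [/\ GLn (@Wminus R) hm, GLn (@Wplus R) hp &
    forall z : circle R, mxeval (val z) q =
      hm z *m diag_mx (\row_j val z ^+ k j) *m hp z].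
Proof.
move=> uq.
have qz (z : circle R) : (\det q).[val z] != 0.
  by rewrite -det_mxeval -unitfE -unitmxE.
have norm1 : `|1 : C| == 1 by rewrite normr1.
have q0 : \det q != 0.
  by apply: contraNneq (qz (Circle norm1)) => ->; rewrite horner0.
have [q1 [U [qE q1P UP]]] := split_roots [pred a : C | 1 < nrm a] q0.
have q10 : \det q1 != 0.
  by apply: contraNneq q0 => h; rewrite qE det_mulmx h mul0r.
have q1w w : 1 <= nrm w -> (\det q1).[w] != 0.
  rewrite le_eqVlt => /orP[/eqP w1|w1]; last first.
    by apply/negP => /q1P; rewrite /= w1.
  have nw : `|w| == 1 by rewrite normr_nrm -w1.
  have := qz (Circle nw); rewrite qE det_mulmx hornerM mulf_eq0 negb_or.
  by case/andP.
have Uw w : nrm w <= 1 -> (\det U).[w] != 0.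
  by move=> w1; apply/negP => /UP /=; rewrite ltNge w1.
have [T [k [uT szP uL0]]] := column_reduce q10.
have [L [LE uL]] := reverse_columns szP uL0.
have Tw w : (\det T).[w] != 0.
  move: uT; rewrite unitmxE poly_unitE => /andP[/size_poly1P[c c0 ->] _].
  by rewrite hornerC.
have iTw w : (\det (invmx T)).[w] != 0.
  have := Tw w; rewrite det_inv => _.
  move: uT; rewrite -unitmx_inv unitmxE -det_inv poly_unitE => /andP[/size_poly1P[c c0 ->] _].
  by rewrite hornerC.
have Lw w : nrm w <= 1 -> (\det L).[w] != 0.
  move=> w1; have [->|w0] := eqVneq w 0.
    by rewrite -det_mxeval -unitfE -unitmxE.
  have wV0 : w^-1 != 0 by rewrite invr_eq0.
  have := LE _ wV0; rewrite invrK => /(congr1 determinant).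
  rewrite det_mxeval det_mulmx hornerM det_mulmx => h.
  have : (\det q1).[w^-1] * (\det T).[w^-1] != 0.
    rewrite mulf_neq0// q1w// nrmV; have nw : 0 < nrm w.
      rewrite lt_neqAle nrm_ge0 andbT eq_sym.
      by apply: contra_neq w0; exact: nrm0_eq0.
    by rewrite invf_ge1.
  by rewrite h det_mxeval mulf_eq0 negb_or => /andP[].
(* inverses of unimodular polynomial matrices have constant determinant, so
   invmx T joins the factor U in W+ *)
have TUw w : nrm w <= 1 -> (\det (invmx T *m U)).[w] != 0.
  by move=> w1; rewrite det_mulmx hornerM mulf_neq0// Uw.
have m0 : [set k : int | k <= 0] 0 by [].
have m1 : [set k : int | k <= 0] (-1) by [].
have mD (i j : int) : [set k | k <= 0] i -> [set k | k <= 0] j -> [set k | k <= 0] (i + j).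
  by rewrite /=; lia.
have p0 : [set k : int | 0 <= k] 0 by [].
have p1 : [set k : int | 0 <= k] 1 by [].
have pD (i j : int) : [set k | 0 <= k] i -> [set k | 0 <= k] j -> [set k | 0 <= k] (i + j).
  by rewrite /=; lia.
exists (fun z => mxeval (zpow (-1) z) L),
  (fun z => mxeval (zpow 1 z) (invmx T *m U)), k; split.
- exact: (GLn_mxeval He m0 mD m1 Lw).
- exact: (GLn_mxeval He p0 pD p1 TUw).
move=> z; have := LE _ (circle_neq0 z).
rewrite (_ : (val z)^-1 = zpow (-1) z); last by rewrite /zpow -invr_expz expr1z.
move=> <-; rewrite zpow1 -mxevalM mulmxA -[q1 *m T *m _]mulmxA mulmxV//.
by rewrite mulmx1 -qE.
Qed.

Lemma sort_permutation (k : 'I_n -> int) :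
  exists s : 'S_n, forall i j : 'I_n, (i <= j)%N -> k (s j) <= k (s i).
Proof.
pose t := sort (fun i j : 'I_n => k j <= k i) (enum 'I_n).
have tn : size t = n by rewrite size_sort -cardE card_ord.
have tu : uniq t by rewrite sort_uniq enum_uniq.
pose f (i : 'I_n) := tnth (Tuple (introT eqP tn)) i.
have fi : injective f.
  move=> i j; rewrite /f !(tnth_nth i)/= => /eqP.
  by rewrite nth_uniq ?tn// => /eqP/val_inj.
exists (perm fi) => i j ij; rewrite !permE /f !(tnth_nth i)/=.
have tr : transitive (fun i j : 'I_n => k j <= k i).
  by move=> x y z h1 h2; exact: le_trans h2 h1.
have srt : sorted (fun i j : 'I_n => k j <= k i) t.
  by apply: sort_sorted => x y; exact: le_total.
have rf : reflexive (fun i j : 'I_n => k j <= k i) by move=> x; exact: lexx.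
by apply: (sorted_leq_nth tr rf i srt); rewrite ?inE ?tn.
Qed.

Lemma circle_birkhoff (g : circle R -> 'M[C]_n) : GLn (@Wcircle R) g ->
  exists hm hp (k : 'I_n -> int), [/\ GLn (@Wminus R) hm, GLn (@Wplus R) hp,
    forall i j : 'I_n, (i <= j)%N -> k j <= k i &
    forall z, g z = invmx (hm z) *m diag_mx (\row_j zpow (k j) z) *m hp z].
Proof.
move=> Gg; have [am [up [m [Gam Gup Wr]]]] := laurent_reduction Gg.
have [q qE] := laurent_poly_mx Wr.
have [[_ ug _] [_ uam _] [_ uup _]] := And3 Gg Gam Gup.
have uq (z : circle R) : mxeval (val z) q \in unitmx.
  rewrite -qE unitmxZ ?unitfE ?expf_neq0 ?circle_neq0//.
  by rewrite !unitmx_mul uam ug uup.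
have [bm [bp [k [Gbm Gbp qF]]]] := polynomial_birkhoff uq.
pose k' j : int := (k j)%:Z - m%:Z.
have [s sP] := sort_permutation k'.
have mD (i j : int) : [set k | k <= 0] i -> [set k | k <= 0] j -> [set k | k <= 0] (i + j).
  by rewrite /=; lia.
have pD (i j : int) : [set k | 0 <= k] i -> [set k | 0 <= k] j -> [set k | 0 <= k] (i + j).
  by rewrite /=; lia.
have GPm : GLn (@Wminus R) (fun=> perm_mx s : 'M[C]_n).
  by apply: (GLn_cst He) => //; exact: unitmx_perm.
have GPp : GLn (@Wplus R) (fun=> perm_mx s : 'M[C]_n).
  by apply: (GLn_cst He) => //; exact: unitmx_perm.
exists (fun z => perm_mx s *m (invmx (bm z) *m am z)),
  (fun z => perm_mx s *m (bp z *m invmx (up z))), (fun j => k' (s j)); split.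
- exact: (GLnM He mD GPm (GLnM He mD (GLnV Gbm) Gam)).
- exact: (GLnM He pD GPp (GLnM He pD Gbp (GLnV Gup))).
- exact: sP.
move=> z; have [[_ ubm _] [_ ubp _]] := conj Gbm Gbp.
(* undo the multiplication by z^m that made the Laurent matrix polynomial *)
have zm : val z ^+ m != 0 by rewrite expf_neq0 ?circle_neq0.
have dE : diag_mx (\row_j val z ^+ k j) = val z ^+ m *: diag_mx (\row_j zpow (k' j) z).
  apply/matrixP => i j; rewrite !mxE mulrnAr; congr (_ *+ _).
  by rewrite /zpow /k' !exprnP -expfzDr ?circle_neq0// addrC subrK.
have gE : am z *m g z *m up z = bm z *m diag_mx (\row_j zpow (k' j) z) *m bp z.
  apply: (scalerI zm); rewrite qE qF dE.
  by rewrite -scalemxAr -scalemxAl.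
have permE : perm_mx s *m diag_mx (\row_j zpow (k' j) z) =
    diag_mx (\row_j zpow (k' (s j)) z) *m perm_mx s.
  apply/matrixP => i j; rewrite mul_mx_diag mul_diag_mx !mxE mulrC.
  by case: eqVneq => [->//|_]; rewrite !mulr0.
have uA : perm_mx s *m (invmx (bm z) *m am z) \in unitmx.
  by rewrite !unitmx_mul unitmx_perm unitmx_inv ubm uam.
have gE' : am z *m g z = bm z *m diag_mx (\row_j zpow (k' j) z) *m bp z *m invmx (up z).
  by rewrite -gE mulmxK.
rewrite -[LHS](mulKmx uA) -!mulmxA; congr (_ *m _).
by rewrite gE' -!mulmxA mulKmx// !mulmxA permE.
Qed.

End Birkhoff.

(** * Pullback and descent between the solenoid and one level *)

Section Pullback.
Variables (R : realType) (n : nat) (N : pint).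
Local Notation C := (Cplx R).

Lemma range_level : range (level N) = invZ N.
Proof.
by apply/seteqP; split=> q; [move=> [k _ <-] | move=> [k ->]]; exists k.
Qed.

Lemma mx_over_pullback (D : set int) (D' : set rat) (f : circle R -> 'M[C]_n) :
  level N @` D `<=` D' -> mx_over (wiener (@zpow R) D) f ->
  mx_over (wiener (@chi R) D') (fun x => f (proj x N)).
Proof.
move=> DD Wf r s; have /(wienerP (zpow_characters R))[c Wc] := Wf r s.
apply/(wienerP (chi_characters R)); exists c.
exact: wiener_le_sub DD (lexx c) (wiener_le_pullback N Wc).
Qed.

Lemma GLn_pullback (D : set int) (D' : set rat) (f : circle R -> 'M[C]_n) :
  level N @` D `<=` D' -> GLn (wiener (@zpow R) D) f ->
  GLn (wiener (@chi R) D') (fun x => f (proj x N)).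
Proof.
move=> DD [f1 f2 f3]; split; first exact: mx_over_pullback DD f1.
  by move=> x; exact: f2.
exact: mx_over_pullback DD f3.
Qed.

Lemma mx_over_descend (g : solenoid R -> 'M[C]_n) :
  mx_over (wiener (@chi R) (invZ N)) g ->
  exists2 h : circle R -> 'M[C]_n, mx_over (@Wcircle R) h &
    forall x, g x = h (proj x N).
Proof.
move=> Wg; have /choice[h hP] (rs : 'I_n * 'I_n) : exists h : circle R -> C,
    @Wcircle R h /\ forall x, g x rs.1 rs.2 = h (proj x N).
  have /(wienerP (chi_characters R))[c Wc] := Wg rs.1 rs.2.
  rewrite -range_level in Wc; have [h Wh gh] := wiener_le_descend Wc.
  by exists h; split=> //; apply/(wienerP (zpow_characters R)); exists c.
exists (fun z => \matrix_(r, s) h (r, s) z).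
  move=> r s; have [+ _] := hP (r, s); congr Wcircle; apply/funext => z.
  by rewrite mxE.
by move=> x; apply/matrixP => r s; rewrite mxE; have [_ <-] := hP (r, s).
Qed.

Lemma invZ0 : invZ N 0. Proof. by exists 0; rewrite mul0r. Qed.

Lemma invZD p q : invZ N p -> invZ N q -> invZ N (p + q).
Proof. by move=> [k ->] [l ->]; exists (k + l); rewrite rmorphD mulrDl. Qed.

Lemma invZ_compl p q : invZ N p -> (~` invZ N) q -> (~` invZ N) (p + q).
Proof.
move=> [k ->] Nq [l kql]; apply: Nq; exists (l - k).
by rewrite rmorphB/= mulrBl -kql addrC addKr.
Qed.

(** Given the descent of g and of g^-1 to level N, their product is 1 on the
    circle because the projection is onto. *)
Lemma bundle_descent (E : bundle R n) :
  fourier_support (@chi R) (cocycle E) `<=` invZ N <->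
  exists EN : bundleP1 R n, is_pullback N EN E.
Proof.
have [Wg ug Wi] := cocycleP E.
rewrite (fourier_support_sub (chi_characters R) _ Wg); split=> [WN|[EN ENE]].
  have WiN := mx_over_inverse_supp (chi_characters R) invZ0 invZD invZ_compl WN Wi
    (fun x => mulmxV (ug x)).
  have [h Wh gh] := mx_over_descend WN.
  have [h' Wh' gh'] := mx_over_descend WiN.
  have hh z : h z *m h' z = 1%:M.
    by have [x <-] := proj_surj N z; rewrite -gh -gh' mulmxV.
  by exists (BundleP1 (GLn_right_inverse Wh Wh' hh)).
have [W1 _ _] := cocycleP1P EN.
have -> : cocycle E = fun x => cocycleP1 EN (proj x N) by apply/funext.
by apply: mx_over_pullback W1 => _ [k _ <-]; exists k.
Qed.

End Pullback.

Theorem theorem11 (R : realType) (n : nat) (N : pint) (E : bundle R n) :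
  (fourier_support (@chi R) (cocycle E) `<=` invZ N <->
     exists EN : bundleP1 R n, is_pullback N EN E) /\
  (fourier_support (@chi R) (cocycle E) `<=` invZ N ->
   exists q : 'I_n -> rat,
     [/\ forall i j : 'I_n, (i <= j)%N -> q j <= q i,
         forall i, invZ N (q i),
         bundle_iso E (dsum_lines (fun i => line R (q i))) &
         exists hm hp : solenoid R -> 'M[Cplx R]_n,
           [/\ GLn (@WQminus R) hm, GLn (@WQplus R) hp &
               forall x, cocycle E x =
                 invmx (hm x) *m diag_mx (\row_i chi (q i) x) *m hp x]]).
Proof.
split; first exact: bundle_descent.
move=> /bundle_descent[EN ENE].
have [hm [hp [k [Ghm Ghp kP gE]]]] := circle_birkhoff (cocycleP1P EN).
have N0 : 0 < (val N)%:R^-1 :> rat by rewrite invr_gt0 ltr0n (valP N).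
have Gm : GLn (@WQminus R) (fun x => hm (proj x N)).
  apply: GLn_pullback Ghm => _ [j /= j0 <-].
  by rewrite /level pmulr_lle0// lerz0.
have Gp : GLn (@WQplus R) (fun x => hp (proj x N)).
  apply: GLn_pullback Ghp => _ [j /= j0 <-].
  by rewrite /level pmulr_lge0// ler0z.
have fact x : cocycle E x = invmx (hm (proj x N)) *m
    diag_mx (\row_i chi (level N (k i)) x) *m hp (proj x N).
  rewrite ENE gE; congr (_ *m diag_mx _ *m _).
  by apply/rowP => i; rewrite !mxE chiE.
exists (fun i => level N (k i)); split.
- by move=> i j ij; rewrite ler_pM2r// ler_int kP.
- by move=> i; exists (k i).
(* an isomorphism carries g to h-^-1 g h+, so both factors are inverted *)
- exists (fun x => invmx (hm (proj x N))), (fun x => invmx (hp (proj x N))).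
  split; [exact: GLnV | exact: GLnV |].
  have [_ um _] := Gm; have [_ up _] := Gp.
  move=> x; rewrite invmxK fact mulmxA (mulmxK (up x)) mulmxA (mulmxV (um x)) mul1mx.
  by congr diag_mx; apply/rowP => i; rewrite !mxE eqxx.
- by exists (fun x => hm (proj x N)), (fun x => hp (proj x N)).
Qed.
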